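(* Let $G$ be a finite group. Suppose $\mathscr{O}$ and $\mathscr{P}$ are cofibrant operads in $\mathbf{Op}^G_+$, and let $\mathscr{O}*_{\mathbf{F}}\mathscr{P}$ be their coproduct in $\mathbf{Op}^G_+$. Then $\mathscr{O}*_{\mathbf{F}}\mathscr{P}$ is also cofibrant, and $$A(\mathscr{O}*_{\mathbf{F}}\mathscr{P})=A(\mathscr{O})\vee A(\mathscr{P}).$$ Consequently, the functor $\mathscr{O}*_{\mathbf{F}}(-):\mathbf{Op}^G_+\to\mathbf{Op}^G_+$ preserves weak equivalences between cofibrant operads whenever $\mathscr{O}$ is cofibrant in $\mathbf{Op}^G_+$.
   Context: $G$ is a finite group. $\mathbf{Op}^G_+$ is the category of marked $G$-operads: symmetric operads $\mathscr{O}$ in left $G$-sets together with chosen elements $u\in\mathscr{O}(0)^G$ and $p\in\mathscr{O}(2)^G$; morphisms are operad maps preserving the markings. Equivalently, $\mathbf{Op}^G_+$ is the category of $G$-operads under $\mathbf{F}$, the free $G$-operad on one $G$-fixed nullary operation and one $G$-fixed binary operation (with free $\Sigma$-action on generators). $\mathscr{O}(n)$ is regarded as a left $G\times\Sigma_n$-set via $(g,\sigma)\cdot x=gx\sigma^{-1}$. A graph subgroup of $G\times\Sigma_n$ is one of the form $\{(h,\sigma(h))\mid h\in H\}$ with $H\subset G$ a subgroup and $\sigma:H\to\Sigma_n$ a homomorphism; if $\sigma$ is a permutation representation of a finite $H$-set $T$ it is denoted $\Gamma(T)$. Let $F_+$ be the left adjoint of the forgetful functor from $\mathbf{Op}^G_+$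 to symmetric sequences of $G$-sets. $\mathbf{Op}^G_+$ carries a model structure in which a morphism $\mathscr{O}\to\mathscr{P}$ is a weak equivalence iff for all $n\ge0$ and graph subgroups $\Gamma\subset G\times\Sigma_n$, $\mathscr{P}(n)^\Gamma\neq\varnothing$ implies $\mathscr{O}(n)^\Gamma\ne\varnothing$; the generating cofibrations are $F_+(\varnothing\to(G\times\Sigma_n)/\Gamma)$ and the generating acyclic cofibrations are $F_+$ of the inclusions $(G\times\Sigma_n)/\Gamma\to(G\times\Sigma_n)/\Gamma\sqcup(G\times\Sigma_n)/\Gamma$, for $n\ge0$ and graph subgroups $\Gamma\subset G\times\Sigma_n$ (orbits being concentrated in arity $n$). Cofibrant means cofibrant in this model structure. $A(\mathscr{O})$ is the class, graded over subgroups $H\subset G$, of all finite $H$-sets $T$ with $\mathscr{O}(|T|)^{\Gamma(T)}\ne\varnothing$. For $\mathscr{O}\in\mathbf{Op}^G_+$ it is a $G$-indexing system: a class $\mathcal{I}$ graded over the subgroups of $G$, with $\mathcal{I}(H)$ a class of finite $H$-sets, containing all finite trivial actions and closed under isomorphism, conjugation, restriction, subobjects, finite coproducts, and self-induction (if $T\in\mathcal{I}(K)$ and $H/K\in\mathcal{I}(H)$ then $H\times_KT\in\mathcal{I}(H)$). Indexing systems are ordered by inclusion and $\mathcal{I}\vee\mathcal{J}$ is the least indexing system containing $\mathcal{I}\cup\mathcal{J}$. *)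

(* Defs.v *)
From mathcomp Require Import all_boot all_order all_fingroup.
From mathcomp Require Import boolp.

Set Implicit Arguments.
Unset Strict Implicit.
Unset Printing Implicit Defensive.

Local Open Scope group_scope.

(** The group [G] is the whole of a [finGroupType] [gT].  Permutations are
    composed as functions in all the laws below: in MathComp [t * s] is
    "first [t], then [s]", so the composite [i |-> s (t i)] is [t * s]. *)

Record gsymseq (gT : finGroupType) := GSymSeq {
  seq_car :> nat -> Type;
  gact : forall n, gT -> seq_car n -> seq_car n;
  sact : forall n, seq_car n -> 'S_n -> seq_car n;
  gact1 : forall n (x : seq_car n), gact 1 x = x;
  gactM : forall n g h (x : seq_car n), gact (g * h) x = gact g (gact h x);
  sact1 : forall n (x : seq_car n), sact x 1 = x;
  sactM : forall n (x : seq_car n) (s t : 'S_n),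
    sact x (t * s) = sact (sact x s) t;
  gact_sact : forall n g (x : seq_car n) (s : 'S_n),
    gact g (sact x s) = sact (gact g x) s
}.
Arguments gact {gT} X [n] g x : rename.
Arguments sact {gT} X [n] x s : rename.

Record seq_hom (gT : finGroupType) (X Y : gsymseq gT) := SeqHom {
  seq_fun :> forall n, X n -> Y n;
  seq_hom_gact : forall n g (x : X n),
    seq_fun (gact X g x) = gact Y g (seq_fun x);
  seq_hom_sact : forall n (x : X n) (s : 'S_n),
    seq_fun (sact X x s) = sact Y (seq_fun x) s
}.
Arguments seq_fun {gT X Y} f [n] x : rename.

Definition seq_comp (gT : finGroupType) (X Y Z : gsymseq gT)
  (g : seq_hom Y Z) (f : seq_hom X Y) : seq_hom X Z.
Proof.
exists (fun n x => g n (f n x)) => *; first by rewrite !seq_hom_gact.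
by rewrite !seq_hom_sact.
Defined.

(** [tagnat.Rank i j] is position [j] of block [i] in
    ['I_(\sum_i m i)], and [tagnat.sig1], [tagnat.sig2] return the block and
    the position of an index. *)

Section BlockPermutations.
Variables (k : nat) (m : 'I_k -> nat).

Lemma sum_perm (s : 'S_k) : (\sum_i m i = \sum_i m (s i))%N.
Proof. exact: (reindex_inj (@perm_inj _ s)). Qed.

Definition block_perm_fun (s : 'S_k) (a : 'I_(\sum_i m i)) :
    'I_(\sum_i m i) :=
  let b := cast_ord (sum_perm s) a : 'I_(\sum_i m (s i)) in
  tagnat.Rank (s (tagnat.sig1 b)) (tagnat.sig2 b).

Lemma block_perm_fun_inj s : injective (block_perm_fun s).
Proof.
move=> a b /tagnat.rank_inj; rewrite /tagnat.sig1 /tagnat.sig2 => e.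
apply: (@cast_ord_inj _ _ (sum_perm s)); apply: tagnat.sig_inj; move: e.
case: (tagnat.sig (cast_ord _ a)) => i x; case: (tagnat.sig (cast_ord _ b)).
move=> j y /= e; have eij : i = j by apply: (@perm_inj _ s); case: e.
by case: _ / eij y e => y e; rewrite (eq_from_Tagged e).
Qed.

(** The block permutation: it takes the [i]-th block, of size [m (s i)], to the
    block [s i], preserving the order inside the block. *)
Definition block_perm (s : 'S_k) : 'S_(\sum_i m i) :=
  perm (@block_perm_fun_inj s).

Definition sum_perm_fun (t : forall i, 'S_(m i)) (a : 'I_(\sum_i m i)) :
    'I_(\sum_i m i) :=
  tagnat.Rank (tagnat.sig1 a) (t (tagnat.sig1 a) (tagnat.sig2 a)).

Lemma sum_perm_fun_inj t : injective (sum_perm_fun t).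
Proof.
move=> a b /tagnat.rank_inj; rewrite /tagnat.sig1 /tagnat.sig2 => e.
apply: tagnat.sig_inj; move: e.
case: (tagnat.sig a) => i x; case: (tagnat.sig b) => j y /= e.
have eij : i = j by case: e.
by case: _ / eij y e => y e; rewrite (perm_inj (eq_from_Tagged e)).
Qed.

Definition sum_perms (t : forall i, 'S_(m i)) : 'S_(\sum_i m i) :=
  perm (@sum_perm_fun_inj t).

End BlockPermutations.

(** Equations between operations whose arities are equal, but not
    convertible, are stated in the total space [{n & O n}]. *)
Record operad (gT : finGroupType) := Operad {
  op_seq :> gsymseq gT;
  op_id : op_seq 1%N;
  op_comp : forall (k : nat) (n : 'I_k -> nat),
    op_seq k -> (forall i, op_seq (n i)) -> op_seq (\sum_i n i)%N;
  op_idl : forall n (y : op_seq n),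
    Tagged op_seq (@op_comp 1 (fun=> n) op_id (fun=> y)) = Tagged op_seq y;
  op_idr : forall k (x : op_seq k),
    Tagged op_seq (@op_comp k (fun=> 1%N) x (fun=> op_id)) = Tagged op_seq x;
  op_assoc : forall k (n : 'I_k -> nat) (m : forall i, 'I_(n i) -> nat)
    (x : op_seq k) (y : forall i, op_seq (n i))
    (z : forall i j, op_seq (m i j)),
    Tagged op_seq
      (op_comp (op_comp x y) (fun a => z (tagnat.sig1 a) (tagnat.sig2 a))) =
    Tagged op_seq (op_comp x (fun i => op_comp (y i) (z i)));
  op_sactl : forall k (m : 'I_k -> nat) (s : 'S_k)
    (x : op_seq k) (y : forall i, op_seq (m i)),
    Tagged op_seq (op_comp (sact op_seq x s) (fun i => y (s i))) =
    Tagged op_seq (sact op_seq (op_comp x y) (block_perm m s));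
  op_sactr : forall k (n : 'I_k -> nat) (t : forall i, 'S_(n i))
    (x : op_seq k) (y : forall i, op_seq (n i)),
    op_comp x (fun i => sact op_seq (y i) (t i)) =
    sact op_seq (op_comp x y) (sum_perms t);
  op_gid : forall g, gact op_seq g op_id = op_id;
  op_gcomp : forall g k (n : 'I_k -> nat)
    (x : op_seq k) (y : forall i, op_seq (n i)),
    gact op_seq g (op_comp x y) =
    op_comp (gact op_seq g x) (fun i => gact op_seq g (y i))
}.
Arguments op_id {gT} O : rename.
Arguments op_comp {gT} O [k n] x y : rename.

Record marked_operad (gT : finGroupType) := MarkedOperad {
  mo_operad :> operad gT;
  mark_u : mo_operad 0%N;
  mark_p : mo_operad 2%N;
  gact_mark_u : forall g, gact mo_operad g mark_u = mark_u;
  gact_mark_p : forall g, gact mo_operad g mark_p = mark_p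
}.
Arguments mark_u {gT} O : rename.
Arguments mark_p {gT} O : rename.

Record marked_hom (gT : finGroupType) (O P : marked_operad gT) := MarkedHom {
  hom_seq :> seq_hom O P;
  hom_id : hom_seq 1%N (op_id O) = op_id P;
  hom_comp : forall k (n : 'I_k -> nat) (x : O k) (y : forall i, O (n i)),
    hom_seq _ (op_comp O x y) =
    op_comp P (hom_seq _ x) (fun i => hom_seq _ (y i));
  hom_u : hom_seq 0%N (mark_u O) = mark_u P;
  hom_p : hom_seq 2%N (mark_p O) = mark_p P
}.

Definition hom_eq (gT : finGroupType) (X Y : gsymseq gT)
  (f g : seq_hom X Y) : Prop := forall n (x : X n), f n x = g n x.

Definition marked_comp (gT : finGroupType) (O P Q : marked_operad gT)
  (g : marked_hom P Q) (f : marked_hom O P) : marked_hom O Q.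
Proof.
exists (seq_comp g f) => * /=.
- by rewrite !hom_id.
- by rewrite !hom_comp.
- by rewrite !hom_u.
- by rewrite !hom_p.
Defined.

(** Both the left adjoint [F_+] and the coproducts below are marked operads
    presented by generators and relations: their operations are terms modulo
    the congruence [teq] generated by the axioms and the relations [R]. *)

Section Presented.
Variables (gT : finGroupType) (X : nat -> Type).

Inductive term : nat -> Type :=
| TGen n (x : X n) : term n
| TId : term 1
| TU : term 0
| TP : term 2
| TG n (g : gT) (t : term n) : term n
| TS n (t : term n) (s : 'S_n) : term n
| TComp k (n : 'I_k -> nat) (t : term k) (ts : forall i, term (n i)) :
    term (\sum_i n i)%N.

Variable R : forall n, term n -> term n -> Prop.

Local Notation "<< t >>" := (Tagged term t).

Inductive teq : {n & term n} -> {n & term n} -> Prop :=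
| teq_rel n (t t' : term n) : R t t' -> teq << t >> << t' >>
| teq_refl a : teq a a
| teq_sym a b : teq a b -> teq b a
| teq_trans a b c : teq a b -> teq b c -> teq a c
| teq_TG n g (t t' : term n) :
    teq << t >> << t' >> -> teq << TG g t >> << TG g t' >>
| teq_TS n (s : 'S_n) (t t' : term n) :
    teq << t >> << t' >> -> teq << TS t s >> << TS t' s >>
| teq_TComp k (n : 'I_k -> nat) (t t' : term k)
    (ts ts' : forall i, term (n i)) :
    teq << t >> << t' >> -> (forall i, teq << ts i >> << ts' i >>) ->
    teq << TComp t ts >> << TComp t' ts' >>
| teq_gact1 n (t : term n) : teq << TG 1 t >> << t >>
| teq_gactM n g h (t : term n) : teq << TG (g * h) t >> << TG g (TG h t) >>
| teq_sact1 n (t : term n) : teq << TS t 1 >> << t >>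
| teq_sactM n (t : term n) (s s' : 'S_n) :
    teq << TS t (s' * s) >> << TS (TS t s) s' >>
| teq_gs n g (t : term n) (s : 'S_n) :
    teq << TG g (TS t s) >> << TS (TG g t) s >>
| teq_idl n (t : term n) :
    teq << @TComp 1 (fun=> n) TId (fun=> t) >> << t >>
| teq_idr k (t : term k) :
    teq << @TComp k (fun=> 1%N) t (fun=> TId) >> << t >>
| teq_assoc k (n : 'I_k -> nat) (m : forall i, 'I_(n i) -> nat)
    (x : term k) (y : forall i, term (n i)) (z : forall i j, term (m i j)) :
    teq << TComp (TComp x y) (fun a => z (tagnat.sig1 a) (tagnat.sig2 a)) >>
        << TComp x (fun i => TComp (y i) (z i)) >>
| teq_sactl k (m : 'I_k -> nat) (s : 'S_k)
    (x : term k) (y : forall i, term (m i)) :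
    teq << TComp (TS x s) (fun i => y (s i)) >>
        << TS (TComp x y) (block_perm m s) >>
| teq_sactr k (n : 'I_k -> nat) (t : forall i, 'S_(n i))
    (x : term k) (y : forall i, term (n i)) :
    teq << TComp x (fun i => TS (y i) (t i)) >>
        << TS (TComp x y) (sum_perms t) >>
| teq_gid g : teq << TG g TId >> << TId >>
| teq_gcomp g k (n : 'I_k -> nat) (x : term k) (y : forall i, term (n i)) :
    teq << TG g (TComp x y) >> << TComp (TG g x) (fun i => TG g (y i)) >>
| teq_gu g : teq << TG g TU >> << TU >>
| teq_gp g : teq << TG g TP >> << TP >>.

Definition tclass n : Type :=
  {S : term n -> Prop | exists t : term n, S = fun t' => teq << t >> << t' >>}.

Definition cls n (t : term n) : tclass n :=
  exist _ (fun t' => teq << t >> << t' >>) (ex_intro _ t erefl).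

Definition trepr n (a : tclass n) : term n := sval (cid (svalP a)).

Lemma cls_eq n (t t' : term n) : teq << t >> << t' >> <-> cls t = cls t'.
Proof.
split=> [e|[]]; last first.
  by move=> /(congr1 (fun S => S t')) ->; apply: teq_refl.
apply: eq_exist; apply/funext => w; apply/propext; split.
  exact/teq_trans/teq_sym.
exact: teq_trans.
Qed.

Lemma treprK n (a : tclass n) : cls (trepr a) = a.
Proof.
rewrite /trepr; case: (cid (svalP a)); case: a => S hS t /= eS.
by apply: eq_exist; rewrite eS.
Qed.

Lemma trepr_cls n (t : term n) : teq << trepr (cls t) >> << t >>.
Proof. by apply/cls_eq; rewrite treprK. Qed.

Lemma tclass_ind n (Q : tclass n -> Prop) :
  (forall t, Q (cls t)) -> forall a, Q a.
Proof. by move=> h a; rewrite -(treprK a). Qed.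

Definition pres_gact n g (a : tclass n) := cls (TG g (trepr a)).
Definition pres_sact n (a : tclass n) (s : 'S_n) := cls (TS (trepr a) s).
Definition pres_comp k (n : 'I_k -> nat) (a : tclass k)
  (b : forall i, tclass (n i)) := cls (TComp (trepr a) (fun i => trepr (b i))).

Lemma pres_gactE n g (t : term n) : pres_gact g (cls t) = cls (TG g t).
Proof. by apply/cls_eq/teq_TG/trepr_cls. Qed.

Lemma pres_sactE n (t : term n) s : pres_sact (cls t) s = cls (TS t s).
Proof. by apply/cls_eq/teq_TS/trepr_cls. Qed.

Lemma pres_compE k (n : 'I_k -> nat) (t : term k)
    (ts : forall i, term (n i)) :
  pres_comp (cls t) (fun i => cls (ts i)) = cls (TComp t ts).
Proof. by apply/cls_eq/teq_TComp => [|i]; apply/trepr_cls. Qed.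

Lemma pres_comp_eq k (n : 'I_k -> nat) (t : term k)
    (ts : forall i, term (n i)) (b : forall i, tclass (n i)) :
  (forall i, b i = cls (ts i)) -> pres_comp (cls t) b = cls (TComp t ts).
Proof.
move=> e; rewrite -pres_compE; congr pres_comp.
exact: functional_extensionality_dep.
Qed.

Definition presE := (pres_gactE, pres_sactE, pres_compE).

Lemma family_repr k (n : 'I_k -> nat) (b : forall i, tclass (n i)) :
  b = fun i => cls (trepr (b i)).
Proof.
by apply: functional_extensionality_dep => i; rewrite treprK.
Qed.

Lemma teq_tag a b : teq a b -> tag a = tag b.
Proof.
elim=> //= {a b}.
- by move=> a b c _ -> _ ->.
- by move=> n _; rewrite big_const_ord iter_addn_0 muln1.
- by move=> k _; rewrite sum_nat_const card_ord muln1.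
- move=> k n m _ _ _.
  rewrite (reindex_onto (@tagnat.rank k n) tagnat.sig) /=; last first.
    by move=> a _; apply: tagnat.sigK.
  rewrite (eq_bigl predT) => [|p]; last by rewrite /= tagnat.rankK eqxx.
  rewrite sig_big_dep /=; apply: eq_bigr => -[i j] _ /=.
  by rewrite /tagnat.sig1 /tagnat.sig2 tagnat.rankK.
- by move=> k m s _ _; rewrite -sum_perm.
Qed.

Lemma cls_eq_tagged n m (t : term n) (t' : term m) :
  teq << t >> << t' >> -> Tagged tclass (cls t) = Tagged tclass (cls t').
Proof.
move=> e; have /= enm := teq_tag e.
by case: _ / enm t' e => t' /cls_eq ->.
Qed.

Definition pres_seq : gsymseq gT.
Proof.
exists tclass pres_gact pres_sact.
- by move=> n; elim/tclass_ind => t; rewrite presE; apply/cls_eq/teq_gact1.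
- move=> n g h; elim/tclass_ind => t; rewrite !presE.
  exact/cls_eq/teq_gactM.
- by move=> n; elim/tclass_ind => t; rewrite presE; apply/cls_eq/teq_sact1.
- move=> n; elim/tclass_ind => t s s'; rewrite !presE.
  exact/cls_eq/teq_sactM.
- move=> n g; elim/tclass_ind => t s; rewrite !presE.
  exact/cls_eq/teq_gs.
Defined.

Definition pres_operad : operad gT.
Proof.
exists pres_seq (cls TId) pres_comp => /=.
- move=> n; elim/tclass_ind => t; rewrite presE.
  exact/cls_eq_tagged/teq_idl.
- move=> k; elim/tclass_ind => t; rewrite presE.
  exact/cls_eq_tagged/teq_idr.
- move=> k n m; elim/tclass_ind => t y z.
  pose ty i := trepr (y i); pose tz i j := trepr (z i j).
  have ey : y = fun i => cls (ty i) by apply: family_repr.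
  have ez i : z i = fun j => cls (tz i j) by apply: family_repr.
  rewrite [in LHS]ey pres_compE (@pres_comp_eq _ _ _
    (fun a => tz (tagnat.sig1 a) (tagnat.sig2 a))); last by move=> a; rewrite ez.
  rewrite (@pres_comp_eq _ _ _ (fun i => TComp (ty i) (tz i))); last first.
    by move=> i; rewrite ez -pres_compE ey.
  exact/cls_eq_tagged/(teq_assoc t ty tz).
- move=> k m s; elim/tclass_ind => t y; rewrite (family_repr y) !presE.
  exact/cls_eq_tagged/(teq_sactl _ t (fun i => trepr (y i))).
- move=> k n s; elim/tclass_ind => t y; rewrite [in RHS](family_repr y).
  rewrite pres_compE pres_sactE (@pres_comp_eq _ _ _ (fun i => TS (trepr (y i)) (s i))).
    exact/cls_eq/teq_sactr.
  by move=> i; rewrite -{1}(treprK (y i)) pres_sactE.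
- by move=> g; rewrite presE; apply/cls_eq/teq_gid.
- move=> g k n; elim/tclass_ind => t y; rewrite [in LHS](family_repr y).
  rewrite pres_compE !pres_gactE (@pres_comp_eq _ _ _ (fun i => TG g (trepr (y i)))).
    exact/cls_eq/teq_gcomp.
  by move=> i; rewrite -{1}(treprK (y i)) pres_gactE.
Defined.

Definition presented : marked_operad gT.
Proof.
exists pres_operad (cls TU) (cls TP) => g /=; rewrite presE; apply/cls_eq.
  exact: teq_gu.
exact: teq_gp.
Defined.

Section Eval.
Variables (P : marked_operad gT) (phi : forall n, X n -> P n).

Fixpoint eval n (t : term n) : P n :=
  match t in term n return P n with
  | TGen _ x => phi x
  | TId => op_id P
  | TU => mark_u P
  | TP => mark_p P
  | TG _ g t => gact P g (eval t)
  | TS _ t s => sact P (eval t) s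
  | TComp _ _ t ts => op_comp P (eval t) (fun i => eval (ts i))
  end.

Hypothesis phiR : forall n (t t' : term n), R t t' -> eval t = eval t'.

Lemma eval_teq a b : teq a b ->
  Tagged P (eval (tagged a)) = Tagged P (eval (tagged b)).
Proof.
elim=> //= {a b}.
- by move=> n t t' /phiR ->.
- by move=> a b c _ -> _ ->.
- by move=> n g t t' _ e; rewrite (eq_from_Tagged e).
- by move=> n s t t' _ e; rewrite (eq_from_Tagged e).
- move=> k n t t' ts ts' _ et _ e; rewrite (eq_from_Tagged et).
  congr (Tagged _ (op_comp _ _ _)); apply: functional_extensionality_dep => i.
  exact: eq_from_Tagged (e i).
- by move=> *; rewrite gact1.
- by move=> *; rewrite gactM.
- by move=> *; rewrite sact1.
- by move=> *; rewrite sactM.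
- by move=> *; rewrite gact_sact.
- by move=> *; rewrite op_idl.
- by move=> *; rewrite op_idr.
- move=> k n m x y z.
  exact: (op_assoc _ (fun i => eval (y i)) (fun i j => eval (z i j))).
- by move=> k m s x y; apply: (op_sactl s _ (fun i => eval (y i))).
- by move=> k n t x y; rewrite -op_sactr.
- by move=> *; rewrite op_gid.
- by move=> *; rewrite op_gcomp.
- by move=> *; rewrite gact_mark_u.
- by move=> *; rewrite gact_mark_p.
Qed.

Definition pres_eval n (a : presented n) : P n := eval (trepr a).

Lemma pres_evalE n (t : term n) : pres_eval (cls t) = eval t.
Proof. exact: eq_from_Tagged (eval_teq (trepr_cls t)). Qed.

Definition pres_lift_seq : seq_hom presented P.
Proof.
exists pres_eval => n.
- by move=> g; elim/tclass_ind => t; rewrite /= pres_gactE !pres_evalE.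
- by elim/tclass_ind => t s; rewrite /= pres_sactE !pres_evalE.
Defined.

Definition pres_lift : marked_hom presented P.
Proof.
exists pres_lift_seq => /= [|k n x y||]; rewrite ?pres_evalE //.
Defined.

Lemma pres_lift_gen n (x : X n) : pres_lift n (cls (TGen x)) = phi x.
Proof. exact: (@pres_evalE n (TGen x)). Qed.

End Eval.

Lemma pres_hom_ext (P : marked_operad gT) (f g : marked_hom presented P) :
  (forall n (x : X n), f n (cls (TGen x)) = g n (cls (TGen x))) ->
  hom_eq f g.
Proof.
move=> e n; elim/tclass_ind; elim=> {n}.
- exact: e.
- by rewrite (hom_id f) (hom_id g).
- by rewrite (hom_u f) (hom_u g).
- by rewrite (hom_p f) (hom_p g).
- by move=> n a t IH; rewrite -pres_gactE !seq_hom_gact IH.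
- by move=> n t IH s; rewrite -pres_sactE !seq_hom_sact IH.
- move=> k n t IH ts IHs; rewrite -pres_compE (hom_comp f) (hom_comp g) IH.
  congr op_comp; apply: functional_extensionality_dep => i; exact: IHs.
Qed.

End Presented.
Arguments TGen {gT X n} x.
Arguments TId {gT X}.
Arguments TU {gT X}.
Arguments TP {gT X}.

Section FreeMarked.
Variable gT : finGroupType.

Inductive Fplus_rel (X : gsymseq gT) : forall n, term gT X n -> term gT X n -> Prop :=
| Fplus_gact n g (x : X n) : Fplus_rel (TGen (gact X g x)) (TG g (TGen x))
| Fplus_sact n (x : X n) s : Fplus_rel (TGen (sact X x s)) (TS (TGen x) s).

Definition Fplus (X : gsymseq gT) : marked_operad gT := presented (@Fplus_rel X).

Definition Fplus_unit (X : gsymseq gT) : seq_hom X (Fplus X).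
Proof.
exists (fun n x => cls (@Fplus_rel X) (TGen x) : Fplus X n) => n.
- by move=> g x; rewrite /= pres_gactE; apply/cls_eq/teq_rel/Fplus_gact.
- by move=> x s; rewrite /= pres_sactE; apply/cls_eq/teq_rel/Fplus_sact.
Defined.

Lemma Fplus_rel_eval (X : gsymseq gT) (O : marked_operad gT)
    (f : seq_hom X O) n (t t' : term gT X n) :
  Fplus_rel t t' -> eval (seq_fun f) t = eval (seq_fun f) t'.
Proof. by case=> * /=; rewrite ?seq_hom_gact ?seq_hom_sact. Qed.

Definition Fplus_lift (X : gsymseq gT) (O : marked_operad gT)
  (f : seq_hom X O) : marked_hom (Fplus X) O :=
  pres_lift (@Fplus_rel_eval X O f).

Theorem Fplus_adjunction (X : gsymseq gT) (O : marked_operad gT)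
    (f : seq_hom X O) :
  hom_eq (seq_comp (Fplus_lift f) (Fplus_unit X)) f /\
  forall h : marked_hom (Fplus X) O,
    hom_eq (seq_comp h (Fplus_unit X)) f -> hom_eq h (Fplus_lift f).
Proof.
have e : hom_eq (seq_comp (Fplus_lift f) (Fplus_unit X)) f.
  by move=> n x; apply: (pres_lift_gen (@Fplus_rel_eval X O f)).
split=> // h eh; apply: pres_hom_ext => n x.
by have /= -> := eh n x; have /= -> := e n x.
Qed.

Definition Fplus_map (X Y : gsymseq gT) (f : seq_hom X Y) :
    marked_hom (Fplus X) (Fplus Y) :=
  Fplus_lift (seq_comp (Fplus_unit Y) f).

End FreeMarked.

Section Coproduct.
Variable gT : finGroupType.

(** The relations which make the generators [i x] the values of a morphism. *)
Inductive hom_rel (X : nat -> Type) (O : marked_operad gT)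
    (i : forall n, O n -> X n) : forall n, term gT X n -> term gT X n -> Prop :=
| hom_rel_gact n g (x : O n) :
    hom_rel i (TGen (i n (gact O g x))) (TG g (TGen (i n x)))
| hom_rel_sact n (x : O n) (s : 'S_n) :
    hom_rel i (TGen (i n (sact O x s))) (TS (TGen (i n x)) s)
| hom_rel_id : hom_rel i (TGen (i 1%N (op_id O))) TId
| hom_rel_comp k (n : 'I_k -> nat) (x : O k) (y : forall j, O (n j)) :
    hom_rel i (TGen (i _ (op_comp O x y)))
      (TComp (TGen (i k x)) (fun j => TGen (i _ (y j))))
| hom_rel_u : hom_rel i (TGen (i 0%N (mark_u O))) TU
| hom_rel_p : hom_rel i (TGen (i 2%N (mark_p O))) TP.

Lemma hom_rel_eval (X : nat -> Type) (O Q : marked_operad gT)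
    (i : forall n, O n -> X n) (f : marked_hom O Q)
    (phi : forall n, X n -> Q n) (ef : forall n x, phi n (i n x) = f n x)
    n (t t' : term gT X n) :
  hom_rel i t t' -> eval phi t = eval phi t'.
Proof.
case=> /= *; rewrite !ef.
- exact: seq_hom_gact.
- exact: seq_hom_sact.
- exact: hom_id.
- rewrite hom_comp; congr op_comp.
  by apply: functional_extensionality_dep => j; rewrite ef.
- exact: hom_u.
- exact: hom_p.
Qed.

Definition hom_rel_map (X : nat -> Type) (O : marked_operad gT)
  (i : forall n, O n -> X n)
  (R : forall n, term gT X n -> term gT X n -> Prop)
  (iR : forall n (t t' : term gT X n), hom_rel i t t' -> R n t t') :
  marked_hom O (presented R).
Proof.
pose e n t t' r := proj1 (@cls_eq _ _ _ n t t') (teq_rel (iR n t t' r)).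
unshelve eexists.
  exists (fun n x => cls R (TGen (i n x)) : presented R n) => n.
  - by move=> g x; rewrite /= pres_gactE; apply/e/hom_rel_gact.
  - by move=> x s; rewrite /= pres_sactE; apply/e/hom_rel_sact.
all: rewrite /=.
- exact/e/hom_rel_id.
- by move=> k n x y; rewrite pres_compE; apply/e/hom_rel_comp.
- exact/e/hom_rel_u.
- exact/e/hom_rel_p.
Defined.

Variables O P : marked_operad gT.

Definition coprod_gen (n : nat) : Type := (O n + P n)%type.

Definition coprod_rel n (t t' : term gT coprod_gen n) : Prop :=
  hom_rel (fun n (x : O n) => inl x : coprod_gen n) t t' \/
  hom_rel (fun n (x : P n) => inr x : coprod_gen n) t t'.

Definition coprod : marked_operad gT := presented coprod_rel.

Definition coprod_inl : marked_hom O coprod :=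
  @hom_rel_map coprod_gen O (fun n => inl) coprod_rel
    (fun n t t' => @or_introl _ _).

Definition coprod_inr : marked_hom P coprod :=
  @hom_rel_map coprod_gen P (fun n => inr) coprod_rel
    (fun n t t' => @or_intror _ _).

Section Copair.
Variables (Q : marked_operad gT) (f : marked_hom O Q) (g : marked_hom P Q).

Definition copair_gen n (x : coprod_gen n) : Q n :=
  match x with inl y => f n y | inr z => g n z end.

Lemma coprod_rel_eval n (t t' : term gT coprod_gen n) :
  coprod_rel t t' -> eval copair_gen t = eval copair_gen t'.
Proof. by case; [apply: (hom_rel_eval (f := f))|apply: (hom_rel_eval (f := g))]. Qed.

Definition copair : marked_hom coprod Q := pres_lift coprod_rel_eval.

End Copair.

Theorem coprod_universal (Q : marked_operad gT)
    (f : marked_hom O Q) (g : marked_hom P Q) :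
  [/\ hom_eq (marked_comp (copair f g) coprod_inl) f,
      hom_eq (marked_comp (copair f g) coprod_inr) g &
      forall h : marked_hom coprod Q,
        hom_eq (marked_comp h coprod_inl) f ->
        hom_eq (marked_comp h coprod_inr) g -> hom_eq h (copair f g)].
Proof.
have e1 : hom_eq (marked_comp (copair f g) coprod_inl) f.
  by move=> n x; apply: (pres_lift_gen (@coprod_rel_eval Q f g)).
have e2 : hom_eq (marked_comp (copair f g) coprod_inr) g.
  by move=> n x; apply: (pres_lift_gen (@coprod_rel_eval Q f g)).
split=> // h eh1 eh2; apply: pres_hom_ext => n [x|x].
- by have /= -> := eh1 n x; have /= -> := e1 n x.
- by have /= -> := eh2 n x; have /= -> := e2 n x.
Qed.

End Coproduct.

Definition coprod_map (gT : finGroupType) (O P P' : marked_operad gT)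
    (f : marked_hom P P') : marked_hom (coprod O P) (coprod O P') :=
  copair (coprod_inl O P') (marked_comp (coprod_inr O P') f).

(** The graph subgroup [{(h, s h) | h in H}], with [s] a homomorphism for the
    composition of permutations as functions. *)
Record graph_subgroup (gT : finGroupType) (n : nat) := GraphSubgroup {
  gs_dom : {group gT};
  gs_map : subg_of gs_dom -> 'S_n;
  gs_mapM : forall h k i, gs_map (h * k) i = gs_map h (gs_map k i)
}.

Arguments gs_map {gT n} Gam h : rename.

(** The left action of [G * Sigma_n] on [X n]. *)
Definition gsact (gT : finGroupType) (X : gsymseq gT) n
  (g : gT) (s : 'S_n) (x : X n) : X n := sact X (gact X g x) s^-1.

Definition gs_fixed (gT : finGroupType) (X : gsymseq gT) n
  (Gam : graph_subgroup gT n) (x : X n) : Prop :=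
  forall h : subg_of (gs_dom Gam), gsact (sgval h) (gs_map Gam h) x = x.

Definition has_fixed (gT : finGroupType) (X : gsymseq gT) n
  (Gam : graph_subgroup gT n) : Prop := exists x : X n, gs_fixed Gam x.

Section Orbit.
Variables (gT : finGroupType) (n : nat) (Gam : graph_subgroup gT n).

(** The coset of [(g, s)].  Permutations of [n] are encoded as bijections from
    ['I_n] to ['I_m], so that the same formula defines the orbit in arity
    [n] and the empty set in the other arities [m]. *)
Definition gs_coset m (g : gT) (s : {ffun 'I_n -> 'I_m}) :
    {set gT * {ffun 'I_n -> 'I_m}} :=
  [set (g * sgval h, [ffun i => s (gs_map Gam h i)])
     | h : subg_of (gs_dom Gam)].

Definition orbit_pred m (A : {set gT * {ffun 'I_n -> 'I_m}}) : bool :=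
  [exists g : gT, exists s : {ffun 'I_n -> 'I_m},
     [&& m == n, injectiveb s & A == gs_coset g s]].

Definition orbit_car (m : nat) : Type :=
  {A : {set gT * {ffun 'I_n -> 'I_m}} | orbit_pred A}.

Definition orbit_mul m (g : gT) (t : 'S_m)
    (A : {set gT * {ffun 'I_n -> 'I_m}}) :=
  [set (g * p.1, [ffun i => t (p.2 i)]) | p : gT * {ffun 'I_n -> 'I_m} in A].

Lemma orbit_mul_pred m g (t : 'S_m) (A : {set gT * {ffun 'I_n -> 'I_m}}) :
  orbit_pred A -> orbit_pred (orbit_mul g t A).
Proof.
case/existsP=> g0 /existsP[s /and3P[emn /injectiveP s_inj /eqP->]].
apply/existsP; exists (g * g0); apply/existsP; exists [ffun i => t (s i)].
apply/and3P; split=> //.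
  by apply/injectiveP => i j; rewrite !ffunE => /perm_inj/s_inj.
apply/eqP; rewrite /orbit_mul /gs_coset -imset_comp; apply: eq_imset => h /=.
by rewrite mulgA; congr pair; apply/ffunP => i; rewrite !ffunE.
Qed.

Definition orbit_act m g t (a : orbit_car m) : orbit_car m :=
  exist _ (orbit_mul g t (val a)) (orbit_mul_pred g t (valP a)).

Lemma orbit_act1 m (a : orbit_car m) : orbit_act 1 1 a = a.
Proof.
apply: val_inj; rewrite /= -[RHS]imset_id; apply: eq_imset => -[g s] /=.
by rewrite mul1g; congr pair; apply/ffunP => i; rewrite ffunE perm1.
Qed.

Lemma orbit_actM m g g' (t t' : 'S_m) (a : orbit_car m) :
  orbit_act g t (orbit_act g' t' a) = orbit_act (g * g') (t' * t) a.
Proof.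
apply: val_inj; rewrite /= /orbit_mul -imset_comp; apply: eq_imset => -[h s] /=.
by rewrite mulgA; congr pair; apply/ffunP => i; rewrite !ffunE permM.
Qed.

Definition orbit_seq : gsymseq gT.
Proof.
exists orbit_car (fun m g => orbit_act g 1) (fun m a t => orbit_act 1 t^-1 a) => m.
- exact: orbit_act1.
- by move=> g h a; rewrite orbit_actM mulg1.
- by move=> a; rewrite invg1 orbit_act1.
- by move=> a s t; rewrite orbit_actM mulg1 invMg.
- by move=> g a s; rewrite !orbit_actM mulg1 mul1g mulg1 mul1g.
Defined.

End Orbit.

Definition empty_seq (gT : finGroupType) : gsymseq gT.
Proof. by exists (fun=> void) (fun _ _ x => x) (fun _ x _ => x). Defined.

Definition from_empty (gT : finGroupType) (X : gsymseq gT) :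
  seq_hom (empty_seq gT) X.
Proof.
by exists (fun n (x : empty_seq gT n) => match x with end) => [n g|n] [].
Defined.

Section ModelStructure.
Variable gT : finGroupType.

Definition weak_equiv (O P : marked_operad gT) (f : marked_hom O P) : Prop :=
  forall n (Gam : graph_subgroup gT n), has_fixed P Gam -> has_fixed O Gam.

Definition lifts (A B X Y : marked_operad gT)
    (i : marked_hom A B) (p : marked_hom X Y) : Prop :=
  forall (a : marked_hom A X) (b : marked_hom B Y),
    hom_eq (marked_comp p a) (marked_comp b i) ->
    exists l : marked_hom B X,
      hom_eq (marked_comp l i) a /\ hom_eq (marked_comp p l) b.

Definition gen_cofibration n (Gam : graph_subgroup gT n) :
    marked_hom (Fplus (empty_seq gT)) (Fplus (orbit_seq Gam)) :=
  Fplus_map (from_empty (orbit_seq Gam)).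

(** As the model structure is cofibrantly generated, its acyclic fibrations and
    cofibrations are obtained from the generating cofibrations by lifting. *)
Definition acyclic_fibration (X Y : marked_operad gT)
    (p : marked_hom X Y) : Prop :=
  forall n (Gam : graph_subgroup gT n), lifts (gen_cofibration Gam) p.

Definition cofibration (A B : marked_operad gT) (i : marked_hom A B) : Prop :=
  forall (X Y : marked_operad gT) (p : marked_hom X Y),
    acyclic_fibration p -> lifts i p.

(** Being a left adjoint, [F_+] takes the empty sequence to the initial marked
    operad. *)
Definition initial_operad : marked_operad gT := Fplus (empty_seq gT).

Definition from_initial (O : marked_operad gT) : marked_hom initial_operad O :=
  Fplus_lift (from_empty O).

Lemma from_initial_unique (O : marked_operad gT)
  (h : marked_hom initial_operad O) : hom_eq h (from_initial O).
Proof. by apply: (Fplus_adjunction (from_empty O)).2 => n []. Qed.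

Definition cofibrant (O : marked_operad gT) : Prop :=
  cofibration (from_initial O).

End ModelStructure.

Record hset (gT : finGroupType) (H : {group gT}) := HSet {
  hset_car :> finType;
  hact : subg_of H -> hset_car -> hset_car;
  hact1 : forall x, hact 1 x = x;
  hactM : forall a b x, hact (a * b) x = hact a (hact b x)
}.
Arguments hact {gT H} T a x : rename.

Section HSets.
Variable gT : finGroupType.
Implicit Types H K : {group gT}.

Definition equivariant H (S T : hset H) (f : S -> T) : Prop :=
  forall a x, f (hact S a x) = hact T a (f x).

Definition hset_triv H (X : finType) : hset H.
Proof. by exists X (fun _ x => x). Defined.

Definition hset_sum H (S T : hset H) : hset H.
Proof.
exists (S + T)%type (fun a x => match x with
  | inl y => inl (hact S a y)
  | inr z => inr (hact T a z) end).
- by case=> x; rewrite hact1.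
- by move=> a b [x|x]; rewrite hactM.
Defined.

Lemma subg1 H : subg H 1 = 1.
Proof. by apply: val_inj; rewrite /= subgK ?group1. Qed.

Definition subg_incl K H (k : subg_of K) : subg_of H := subg H (sgval k).

Lemma subg_inclM K H : K \subset H ->
  forall a b : subg_of K, subg_incl H (a * b) = subg_incl H a * subg_incl H b.
Proof. by move=> /subsetP sKH a b; apply: subgM; apply/sKH/subgP. Qed.

Definition hset_res K H (sKH : K \subset H) (T : hset H) : hset K.
Proof.
exists T (fun k => hact T (subg_incl H k)) => [x|a b x].
- by rewrite /subg_incl subg1 hact1.
- by rewrite subg_inclM // hactM.
Defined.

(** The conjugate subgroup is [H :^ g = g^-1 H g]; an element [k] of it acts as
    [g k g^-1] does on [T]. *)
Definition subg_conj H g (k : subg_of (H :^ g)%G) : subg_of H :=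
  subg H (sgval k ^ g^-1).

Lemma subg_conjM H g (a b : subg_of (H :^ g)%G) :
  subg_conj (a * b) = subg_conj a * subg_conj b.
Proof.
rewrite /subg_conj [sgval (a * b)]/(sgval a * sgval b) conjMg.
by apply: subgM; rewrite -mem_conjg subgP.
Qed.

Definition hset_conj H g (T : hset H) : hset (H :^ g)%G.
Proof.
exists T (fun k => hact T (subg_conj k)) => [x|a b x].
- by rewrite /subg_conj conj1g subg1 hact1.
- by rewrite subg_conjM hactM.
Defined.

Lemma lcosets_mul H K (A : {set gT}) (a : subg_of H) :
  A \in lcosets K H -> sgval a *: A \in lcosets K H.
Proof.
case/lcosetsP=> x Hx ->; apply/lcosetsP; exists (sgval a * x).
  by rewrite groupM ?subgP.
by rewrite lcosetM.
Qed.

Definition cosets_act H K (a : subg_of H)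
    (A : {A : {set gT} | A \in lcosets K H}) :
    {A : {set gT} | A \in lcosets K H} :=
  exist _ (sgval a *: sval A) (lcosets_mul a (svalP A)).

Definition hset_cosets H K : hset H.
Proof.
exists {A : {set gT} | A \in lcosets K H} (@cosets_act H K).
- by move=> A; apply: val_inj; rewrite /= lcoset1.
- by move=> a b A; apply: val_inj; rewrite /= lcosetM.
Defined.

Section Induced.
Variables (K H : {group gT}) (T : hset K).

(** The class [{(a k^-1, k t) | k in K}] of [(a, t)] in [H *_K T], for
    [K \subset H]. *)
Definition ind_class (a : subg_of H) (t : T) : {set subg_of H * T} :=
  [set (a * subg_incl H k^-1, hact T k t) | k : subg_of K].

Definition ind_pred (A : {set subg_of H * T}) : bool :=
  [exists a, exists t, A == ind_class a t].

Definition ind_mul (b : subg_of H) (A : {set subg_of H * T}) :=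
  [set (b * p.1, p.2) | p in A].

Lemma ind_mul_pred b A : ind_pred A -> ind_pred (ind_mul b A).
Proof.
case/existsP=> a /existsP[t /eqP->].
apply/existsP; exists (b * a); apply/existsP; exists t; apply/eqP.
by rewrite /ind_mul -imset_comp; apply: eq_imset => k /=; rewrite mulgA.
Qed.

Definition ind_act (b : subg_of H) (A : {A | ind_pred A}) : {A | ind_pred A} :=
  exist _ (ind_mul b (sval A)) (ind_mul_pred b (svalP A)).

Definition hset_ind : hset H.
Proof.
exists {A : {set subg_of H * T} | ind_pred A} ind_act.
- move=> A; apply: val_inj; rewrite /= -[RHS]imset_id.
  by apply: eq_imset => -[a t]; rewrite /= mul1g.
- move=> b c A; apply: val_inj; rewrite /= /ind_mul -imset_comp.
  by apply: eq_imset => -[a t]; rewrite /= mulgA.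
Defined.

End Induced.

Definition hclass : Type := forall H, hset H -> Prop.

Definition hclass_le (I J : hclass) : Prop :=
  forall H (T : hset H), I H T -> J H T.

Record indexing_system (I : hclass) : Prop := IndexingSystem {
  is_triv : forall H (X : finType), I H (hset_triv H X);
  is_iso : forall H (S T : hset H) (f : S -> T),
    bijective f -> equivariant f -> I H S -> I H T;
  is_conj : forall H g (T : hset H), I H T -> I (H :^ g)%G (hset_conj g T);
  is_res : forall K H (sKH : K \subset H) (T : hset H),
    I H T -> I K (hset_res sKH T);
  is_sub : forall H (S T : hset H) (f : S -> T),
    injective f -> equivariant f -> I H T -> I H S;
  is_sum : forall H (S T : hset H), I H S -> I H T -> I H (hset_sum S T);
  is_ind : forall K H (T : hset K), K \subset H ->
    I K T -> I H (hset_cosets H K) -> I H (hset_ind H T)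
}.

Definition is_join (I J L : hclass) : Prop :=
  [/\ indexing_system L, hclass_le I L, hclass_le J L &
      forall M : hclass, indexing_system M ->
        hclass_le I M -> hclass_le J M -> hclass_le L M].

Lemma hact_inj H (T : hset H) a : injective (hact T a).
Proof. by apply: (can_inj (g := hact T a^-1)) => x; rewrite -hactM mulVg hact1. Qed.

Definition hset_perm_fun H (T : hset H) (a : subg_of H) (i : 'I_#|T|) :
  'I_#|T| := enum_rank (hact T a (enum_val i)).

Lemma hset_perm_fun_inj H (T : hset H) a : injective (@hset_perm_fun H T a).
Proof. by move=> i j /enum_rank_inj/hact_inj/enum_val_inj. Qed.

(** The graph subgroup of [T], for the enumeration of [T] given by its
    [finType] structure. *)
Definition hset_graph H (T : hset H) : graph_subgroup gT #|T|.
Proof.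
exists H (fun a => perm (@hset_perm_fun_inj H T a)) => a b i.
by rewrite !permE /hset_perm_fun enum_rankK hactM.
Defined.

Definition admissible (O : marked_operad gT) : hclass :=
  fun H T => has_fixed O (hset_graph T).

End HSets.

(* Main.v *)
(** The coproduct of cofibrant operads is cofibrant because lifts against an
    acyclic fibration can be chosen on each summand, [F_+] of the empty sequence
    being initial.  Both [A(O)] and [A(P)] lie in [A(O * P)], which is an indexing
    system, so the point is that [A(O * P)] lies in every indexing system [M]
    containing [A(O)] and [A(P)].  If [Q] is a marked operad with [A(Q) = M], the
    projection [O x Q -> O] is an acyclic fibration, because [A(O)] lies in
    [A(Q)]; a section of it, which exists as [O] is cofibrant, yields a map
    [O -> Q].  Likewise there is a map [P -> Q], hence a map [O * P -> Q], and
    maps preserve fixed points.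

    Such a [Q] is found inside the endomorphism operad of a [G]-set of trees with
    labelled leaves.  Call a tree nice if, whenever a subgroup [H] fixes it, its
    set of leaves is in [M(H)], and let [Q] consist of the functions which take
    nice trees with disjoint leaves to a nice tree whose leaves are the union of
    theirs.  Evaluating an operation fixed by the graph of [T] at generic leaves
    labelled by [T] shows that [T] is in [M].  Conversely, for [T] in [M(H)], the
    operation grafting its arguments on a node that remembers [H] is in [Q]: if
    [K] fixes the resulting tree then [K] is a subgroup of [H], and the leaves
    fibre over the restriction of [T] to [K]. *)

From mathcomp Require Import all_boot all_order all_fingroup.
From mathcomp Require Import boolp.
Require Import Defs.

Set Implicit Arguments.
Unset Strict Implicit.
Unset Printing Implicit Defensive.

Local Open Scope group_scope.

(** * Symmetries of operadic composites *)

Lemma gsact_fixE (gT : finGroupType) (X : gsymseq gT) n g (s : 'S_n) (x : X n) :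
  gsact g s x = x <-> gact X g x = sact X x s.
Proof.
rewrite /gsact; split=> [{2}<-|->]; rewrite -sactM.
  by rewrite mulgV sact1.
by rewrite mulVg sact1.
Qed.

Lemma RankE k (m m' : 'I_k -> nat) (i : 'I_k) (j : 'I_(m i)) (j' : 'I_(m' i)) :
  m =1 m' -> j = j' :> nat -> tagnat.Rank i j = tagnat.Rank i j' :> nat.
Proof.
by move=> e ej; rewrite !tagnat.RankEsum ej; congr (_ + _)%N; apply: eq_bigr.
Qed.

(** A dependent [F] is needed because the type of [sig2] mentions [sig1], so the two cannot be
    rewritten separately. *)
Lemma sig_Rank k (m : 'I_k -> nat) (A : Type) (F : forall i, 'I_(m i) -> A)
    (i : 'I_k) (j : 'I_(m i)) :
  F (tagnat.sig1 (tagnat.Rank i j)) (tagnat.sig2 (tagnat.Rank i j)) = F i j.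
Proof. by rewrite /tagnat.sig1 /tagnat.sig2 /tagnat.Rank tagnat.rankK. Qed.

(** The equivariance axioms pull [s] and the [t i] out of the composite, as a block permutation
    followed by permutations inside the blocks. Tags are used because [m i] and [m (s i)] need not
    be convertible. *)
Lemma gact_op_comp (gT : finGroupType) (O : operad gT) k (m : 'I_k -> nat)
    (x : O k) (y : forall i, O (m i)) g (s : 'S_k) (t : forall i, 'S_(m i)) :
  gact O g x = sact O x s ->
  (forall i, Tagged O (gact O g (y i)) =
             Tagged O (sact O (y (s i)) (t (s i)))) ->
  exists2 p : 'S_(\sum_i m i),
    gact O g (op_comp O x y) = sact O (op_comp O x y) p &
    forall i (j : 'I_(m i)) (j' : 'I_(m (s i))), j = j' :> nat ->
      p (tagnat.Rank i j) = tagnat.Rank (s i) (t (s i) j').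
Proof.
move=> ex ey; exists (block_perm m s * sum_perms t).
  apply: eq_from_Tagged; rewrite op_gcomp sactM -op_sactr -op_sactl ex.
  (* The whole family of tagged operations is replaced at once, so that no cast between arities
     arises. *)
  pose yy := fun i => Tagged O (gact O g (y i)).
  pose yy' := fun i => Tagged O (sact O (y (s i)) (t (s i))).
  have e : yy = yy' by apply/funext.
  pose F (z : 'I_k -> {n & O n}) :=
    Tagged O (op_comp O (sact O x s) (fun i => tagged (z i))).
  by rewrite -[LHS]/(F yy) e.
have em i : m i = m (s i) by have := congr1 tag (ey i).
move=> i j j' ej; rewrite permM !permE /block_perm_fun.
have -> : cast_ord (sum_perm m s) (tagnat.Rank i j) = tagnat.Rank i j'.
  by apply: val_inj; apply: (RankE (m' := fun i => m (s i))).
rewrite (sig_Rank (fun i j => tagnat.Rank (p_ := m) (s i) j) j').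
exact: (sig_Rank (fun i j => tagnat.Rank i (t i j))).
Qed.

(** * Admissibility in terms of labellings *)

Lemma gs_map1 (gT : finGroupType) n (Gam : graph_subgroup gT n) i :
  gs_map Gam 1 i = i.
Proof. by apply: (@perm_inj _ (gs_map Gam 1)); rewrite -gs_mapM mulg1. Qed.

(** Inverse to [hset_graph] up to isomorphism, so conditions on graph subgroups become conditions on
    finite sets with action. *)
Definition gs_hset (gT : finGroupType) n (Gam : graph_subgroup gT n) :
  hset (gs_dom Gam) :=
  @HSet gT (gs_dom Gam) 'I_n (gs_map Gam) (gs_map1 Gam) (@gs_mapM _ _ Gam).

(** A labelling of [A] by the inputs of an [n]-ary operation; labels are bare
    numbers, so that they need no casts when arities are only provably equal. *)
Definition enumerates (A : Type) n (e : A -> nat) : Prop :=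
  [/\ injective e, forall a, (e a < n)%N & forall i, (i < n)%N -> exists a, e a = i].

(** When [e] enumerates [T], the last clause determines [s], so [x] is fixed by the graph of [T]
    read through the labels. *)
Definition realizes (gT : finGroupType) (O : gsymseq gT) (H : {group gT})
    (T : hset H) n (e : T -> nat) (x : O n) : Prop :=
  forall h : subg_of H, exists2 s : 'S_n, gact O (sgval h) x = sact O x s &
    forall t (i : 'I_n), i = e t :> nat -> s i = e (hact T h t) :> nat.

Section Admissible.
Variables (gT : finGroupType) (O : marked_operad gT).

Definition has_op (H : {group gT}) (T : hset H) : Prop :=
  exists n (e : T -> nat) (x : O n), enumerates n e /\ realizes e x.

Lemma has_op_iso (H : {group gT}) (S T : hset H) (f : S -> T) :
  bijective f -> equivariant f -> has_op S -> has_op T.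
Proof.
case=> g fK gK feq [n [e [x [[e_inj e_lt e_surj] ex]]]].
exists n, (e \o g), x; split; first split=> [||i /e_surj[a <-]] /=.
- exact: inj_comp e_inj (can_inj gK).
- by move=> a; apply: e_lt.
- by exists (f a); rewrite fK.
move=> h; have [s es st] := ex h; exists s => // t i /st ->.
by rewrite /= -{2}(gK t) -feq fK.
Qed.

Lemma has_fixed_has_op n (Gam : graph_subgroup gT n) :
  has_fixed O Gam <-> has_op (gs_hset Gam).
Proof.
split=> [[x ex]|[n' [e [x [[e_inj e_lt e_surj] ex]]]]].
  exists n, val, x; split.
    split=> [|i|i lt_i]; [exact: val_inj|exact: ltn_ord|].
    by exists (Ordinal lt_i).
  move=> h; exists (gs_map Gam h) => [|t i /val_inj -> //].
  by have /gsact_fixE := ex h.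
pose e' i := Ordinal (e_lt i).
have e'_inj : injective e' by move=> i j /(congr1 val)/= /e_inj.
(* [e'] is a bijection, which forces the two arities to agree. *)
have en : n = n'.
  have : bijective e'.
    apply: (inj_card_bij e'_inj); rewrite !card_ord.
    have [|f ef] := @boolp.choice _ _ (fun i j => e' j = i).
      by move=> i; have [j ej] := e_surj i (ltn_ord i); exists j; apply: val_inj.
    by have := leq_card _ (can_inj ef); rewrite !card_ord.
  by move/bij_eq_card; rewrite !card_ord.
case: _ / en in x ex e_lt e_surj e' e'_inj *.
(* Permuting the inputs by [p] gives each [i] the label [i]. *)
pose p := perm e'_inj; exists (sact O x p) => h; apply/gsact_fixE.
have [s es st] := ex h; rewrite gact_sact es -!sactM; congr sact.
apply/permP => i; rewrite !permM; apply: val_inj.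
by rewrite !permE; apply: (st i (e' i)).
Qed.

Lemma admissibleP (H : {group gT}) (T : hset H) : admissible O T <-> has_op T.
Proof.
rewrite /admissible has_fixed_has_op; split.
  apply: (@has_op_iso H (gs_hset (hset_graph T)) T enum_val).
    exact: enum_val_bij.
  by move=> a i; rewrite /= permE enum_rankK.
apply: (@has_op_iso H T (gs_hset (hset_graph T)) enum_rank).
  exact: enum_rank_bij.
by move=> a i; rewrite /= permE /hset_perm_fun enum_rankK.
Qed.

Lemma has_fixed_admissible n (Gam : graph_subgroup gT n) :
  has_fixed O Gam <-> admissible O (gs_hset Gam).
Proof. by rewrite admissibleP has_fixed_has_op. Qed.

(** The composite of an operation for [S] with coherent operations [y s] for the
    fibres of [phi] is an operation for [T].  All closure properties of
    admissible sets that involve a composition are instances. *)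
Lemma has_op_fibration (H : {group gT}) (S T : hset H) (phi : T -> S)
    (n : S -> nat) (e : T -> nat) (y : forall s, O (n s)) :
  equivariant phi -> has_op S ->
  (forall t t', phi t = phi t' -> e t = e t' -> t = t') ->
  (forall t, (e t < n (phi t))%N) ->
  (forall s i, (i < n s)%N -> exists2 t, phi t = s & e t = i) ->
  (forall h s, exists2 p : 'S_(n (hact S h s)),
     Tagged O (gact O (sgval h) (y s)) = Tagged O (sact O (y (hact S h s)) p) &
     forall t (i : 'I_(n (hact S h s))), phi t = s -> i = e t :> nat ->
       p i = e (hact T h t) :> nat) ->
  has_op T.
Proof.
move=> phi_eq [k [eS [x [[eS_inj eS_lt eS_surj] ex]]]] e_inj e_lt e_surj coh.
have [|d dK] := @boolp.choice 'I_k S (fun i a => eS a = i).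
  by move=> i; apply: eS_surj.
pose c a := Ordinal (eS_lt a).
have cK : cancel c d by move=> a; apply: eS_inj; rewrite dK.
have dcK : cancel d c by move=> i; apply: val_inj; rewrite /= dK.
pose m i := n (d i); pose z := op_comp O x (fun i => y (d i)).
have lt_e t : (e t < m (c (phi t)))%N by rewrite /m cK.
(* The new label of [t] is position [e t] in the block of [phi t]. *)
pose r t : 'I_(\sum_i m i) := tagnat.Rank (c (phi t)) (Ordinal (lt_e t)).
exists (\sum_i m i)%N, r, z; split; first split.
- move=> t t' /eqP; rewrite tagnat.eq_Rank => /andP[/eqP ec /eqP et].
  by apply: e_inj => //; apply: (can_inj cK).
- by move=> t; apply: ltn_ord.
- move=> a lt_a; pose b := Ordinal lt_a.
  have [t et ei] := e_surj _ _ (ltn_ord (tagnat.sig2 b)); exists t.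
  rewrite -[a]/(nat_of_ord b) -(tagnat.sig2K b); apply/eqP.
  by rewrite tagnat.eq_Rank /= ei et dcK !eqxx.
move=> h; have [s es st] := ex h.
have sd i : hact S h (d i) = d (s i).
  by apply: eS_inj; rewrite dK (st (d i)) // dK.
(* [gact_op_comp] wants permutations indexed by the target block. Quantifying over every [j] with
   [s j = i] avoids a transport along [s (s^-1 i) = i]. *)
have eq i : exists p : 'S_(m i), forall j, s j = i ->
    Tagged O (gact O (sgval h) (y (d j))) = Tagged O (sact O (y (d i)) p) /\
    forall t (l : 'I_(m i)), phi t = d j -> l = e t :> nat ->
       p l = e (hact T h t) :> nat.
  have := coh h (d (s^-1 i)); rewrite sd permKV => -[p e1 e2].
  by exists p => j ej; have -> : j = s^-1 i by rewrite -ej permK.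
pose q i := sval (cid (eq i)).
have eqE i := svalP (cid (eq i)).
have [|p ep pR] := @gact_op_comp gT O k m x (fun i => y (d i)) (sgval h) s q es.
  by move=> i; have [] := eqE (s i) i erefl.
exists p => // t a /val_inj ->; apply/eqP.
have em : m (c (phi t)) = m (s (c (phi t))).
  by have [/(congr1 tag)] := eqE (s (c (phi t))) (c (phi t)) erefl.
rewrite (pR _ _ (cast_ord em (Ordinal (lt_e t)))) // tagnat.eq_Rank.
have [_ qE] := eqE (s (c (phi t))) (c (phi t)) erefl.
rewrite (qE t) ?cK //= eqxx andbT.
by rewrite -val_eqE /= (st (phi t)) // phi_eq.
Qed.

End Admissible.
Lemma subg_inclE (gT : finGroupType) (K H : {group gT}) (k : subg_of K) :
  K \subset H -> sgval (subg_incl H k) = sgval k.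
Proof. by move=> /subsetP sKH; rewrite subgK // sKH ?subgP. Qed.

(** * Admissible sets form an indexing system *)

Section Induction.
Variables (gT : finGroupType) (K H : {group gT}) (T : hset K).
Hypothesis sKH : K \subset H.

Lemma ind_pred_class (a : subg_of H) (t : T) : ind_pred (ind_class a t).
Proof. by apply/existsP; exists a; apply/existsP; exists t. Qed.

Definition ind_pt a t : hset_ind H T :=
  exist (fun A => ind_pred A) (ind_class a t) (ind_pred_class a t).

Lemma ind_ptP (A : hset_ind H T) : exists a t, A = ind_pt a t.
Proof.
have /existsP[a /existsP[t /eqP eA]] := svalP A.
by exists a, t; apply: val_inj.
Qed.

Lemma subg_incl1 : subg_incl H (1 : subg_of K) = 1.
Proof. by rewrite /subg_incl subg1. Qed.

Lemma ind_classP a b (t t' : T) :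
  reflect (exists2 k, b = a * subg_incl H k^-1 & t' = hact T k t)
          ((b, t') \in ind_class a t).
Proof.
by apply: (iffP imsetP) => [[k _ [-> ->]]|[k -> ->]]; exists k.
Qed.

Lemma ind_pt_eq a (t : T) k :
  ind_pt (a * subg_incl H k) t = ind_pt a (hact T k t).
Proof.
apply: val_inj; apply/setP => -[b t'] /=; apply/ind_classP/ind_classP => -[l -> ->].
  exists (l * k^-1); last by rewrite -hactM mulgKV.
  by rewrite invMg invgK subg_inclM // mulgA.
exists (l * k); last by rewrite hactM.
rewrite invMg subg_inclM // -mulgA (mulgA _ (subg_incl H k^-1)).
by rewrite -subg_inclM // mulgV subg_incl1 mul1g.
Qed.

Lemma hact_ind_pt h a t : hact (hset_ind H T) h (ind_pt a t) = ind_pt (h * a) t.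
Proof.
apply: val_inj; rewrite /= /ind_mul /ind_class -imset_comp.
by apply: eq_imset => k /=; rewrite mulgA.
Qed.

(** Universal property of the induced set: [F] is balanced over [K], hence constant on classes. *)
Lemma ind_lift (U : Type) (F : subg_of H -> T -> U) :
  (forall a k t, F (a * subg_incl H k) t = F a (hact T k t)) ->
  exists f : hset_ind H T -> U, forall a t, f (ind_pt a t) = F a t.
Proof.
move=> eF; have [|f ef] := @boolp.choice (hset_ind H T) U
  (fun A u => exists a t, A = ind_pt a t /\ u = F a t).
  by move=> A; have [a [t ->]] := ind_ptP A; exists (F a t), a, t.
exists f => a t; have [b [t' [e ->]]] := ef (ind_pt a t).
have : (a, t) \in ind_class b t'.
  have /(congr1 val)/= <- := e; apply/ind_classP; exists 1; last by rewrite hact1.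
  by rewrite invg1 subg_incl1 mulg1.
by case/ind_classP=> k -> ->; rewrite eF -hactM mulVg hact1.
Qed.

Lemma coset_pt_proof (a : subg_of H) : sgval a *: K \in lcosets K H.
Proof. by apply/lcosetsP; exists (sgval a); rewrite ?subgP. Qed.

Definition coset_pt a : hset_cosets H K :=
  exist (fun A => A \in lcosets K H) (sgval a *: K) (coset_pt_proof a).

Lemma coset_ptP (A : hset_cosets H K) : exists a, coset_pt a = A.
Proof.
have /lcosetsP[a Ha eA] := svalP A; exists (subg H a); apply: val_inj.
by rewrite /= subgK.
Qed.

Lemma coset_pt_eq a b :
  coset_pt a = coset_pt b <-> exists k : subg_of K, a = b * subg_incl H k.
Proof.
split=> [/(congr1 val)/= e|[k ->]].
  have : sgval a \in sgval b *: K by rewrite -e lcoset_refl.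
  case/lcosetP=> k Kk ek; exists (subg K k); apply: val_inj.
  by rewrite [RHS]/= subg_inclE // subgK.
apply: val_inj; rewrite /= subg_inclE //; apply/lcoset_eqP.
by rewrite mem_lcoset mulKg subgP.
Qed.

Lemma hact_coset_pt h a : hact (hset_cosets H K) h (coset_pt a) = coset_pt (h * a).
Proof. by apply: val_inj; rewrite /= lcosetM. Qed.

End Induction.

Section AdmissibleIndexing.
Variables (gT : finGroupType) (O : marked_operad gT).
Implicit Types H K : {group gT}.

Lemma has_op_void H (T : hset H) : (T -> False) -> has_op O T.
Proof.
move=> T0; exists 0%N, (fun=> 0%N), (mark_u O); split.
  by split=> [t||//] t'; [case: (T0 t)|case: (T0 t')].
by move=> h; exists 1 => [|t]; [rewrite gact_mark_u sact1|case: (T0 t)].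
Qed.

Lemma has_op_unit H : has_op O (hset_triv H unit).
Proof.
exists 1%N, (fun=> 0%N), (op_id O); split.
  by split=> [[] []||[] // _] //; exists tt.
by move=> h; exists 1 => [|t i e]; [rewrite op_gid sact1|rewrite perm1].
Qed.

Lemma has_op_bool H : has_op O (hset_triv H bool).
Proof.
exists 2%N, nat_of_bool, (mark_p O); split.
  by split=> [[] []|[]|[|[|//]] _] //; [exists false|exists true].
by move=> h; exists 1 => [|t i e]; [rewrite gact_mark_p sact1|rewrite perm1].
Qed.

(** The sum fibres over the trivial two-point set, for which [mark_p] is an operation. *)
Lemma has_op_sum H (S T : hset H) :
  has_op O S -> has_op O T -> has_op O (hset_sum S T).
Proof.
move=> [n1 [e1 [x1 [[inj1 lt1 surj1] ex1]]]] [n2 [e2 [x2 [[inj2 lt2 surj2] ex2]]]].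
apply: (@has_op_fibration gT O H (hset_triv H bool) (hset_sum S T)
  (fun a => match a with inl _ => false | inr _ => true end)
  (fun b => if b then n2 else n1)
  (fun a => match a with inl s => e1 s | inr t => e2 t end)
  (fun b => match b return O (if b then n2 else n1) with
    true => x2 | false => x1 end)).
- by move=> h [].
- exact: has_op_bool.
- by move=> [a|a] [b|b] //= _ => [/inj1->|/inj2->].
- by case=> a.
- by case=> i => [/surj2[a]|/surj1[a]] <-; [exists (inr a)|exists (inl a)].
move=> h [] /=.
  by have [s -> es] := ex2 h; exists s => // -[a|a] i // _; apply: es.
by have [s -> es] := ex1 h; exists s => // -[a|a] i // _; apply: es.
Qed.

Lemma has_op_triv H (X : finType) : has_op O (hset_triv H X).
Proof.
suff IH n : has_op O (hset_triv H 'I_n).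
  apply: (@has_op_iso _ _ _ (hset_triv H 'I_#|X|) (hset_triv H X) enum_val) => //.
  exact: enum_val_bij.
elim: n => [|n IH]; first by apply: has_op_void => -[].
apply: (@has_op_iso _ _ _ (hset_sum (hset_triv H 'I_n) (hset_triv H unit))
  (hset_triv H 'I_n.+1)
  (fun a => match a with inl i => lift ord0 i | inr _ => ord0 end)).
- apply: inj_card_bij; last by rewrite card_sum card_unit !card_ord addn1.
  by move=> [i|[]] [j|[]] // /lift_inj->.
- by move=> h [].
- exact: has_op_sum IH (has_op_unit H).
Qed.

(** The translate by [g^-1] of an operation for [T] serves, with the same labels. *)
Lemma has_op_conj H g (T : hset H) : has_op O T -> has_op O (hset_conj g T).
Proof.
move=> [n [e [x [en ex]]]]; exists n, e, (gact O g^-1 x); split=> // h.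
have [s es st] := ex (subg_conj h); exists s; last exact: st.
have eh : sgval (subg_conj h) = sgval h ^ g^-1.
  by rewrite subgK // -mem_conjg subgP.
by rewrite -gact_sact -es eh -!gactM; congr gact; rewrite conjgE invgK mulKg.
Qed.

Lemma has_op_res K H (sKH : K \subset H) (T : hset H) :
  has_op O T -> has_op O (hset_res sKH T).
Proof.
move=> [n [e [x [en ex]]]]; exists n, e, x; split=> // h.
by have [s] := ex (subg_incl H h); rewrite subg_inclE // => es st; exists s.
Qed.

(** Into an operation for [T], insert the identity at the points of the image of [f] and [mark_u] at
    the others. *)
Lemma has_op_sub H (S T : hset H) (f : S -> T) :
  injective f -> equivariant f -> has_op O T -> has_op O S.
Proof.
move=> f_inj f_eq; pose b t := [exists s, f s == t].
have bf s : b (f s) by apply/existsP; exists s.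
pose y (c : bool) := if c return O c then op_id O else mark_u O.
move=> opT; apply: (@has_op_fibration gT O H T S f b (fun=> 0%N)
  (fun t => y (b t))) => //.
- by move=> s s' /f_inj.
- by move=> s; rewrite bf.
- move=> t [|i] /=; last by case: (b t).
  by rewrite lt0b => /existsP[s /eqP <-]; exists s.
move=> h t; exists 1; last first.
  by move=> s i est _; rewrite perm1; case: i; rewrite -est -f_eq bf; case.
have -> : b (hact T h t) = b t.
  apply/existsP/existsP => -[s /eqP es]; last first.
    by exists (hact S h s); rewrite f_eq es.
  by exists (hact S h^-1 s); rewrite f_eq es -hactM mulVg hact1.
by rewrite sact1; case: (b t); rewrite /= ?op_gid ?gact_mark_u.
Qed.

(** The induced set fibres over [H/K]; over a coset with chosen representative [r A], the translate
    of [x] by [r A] is used. *)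
Lemma has_op_ind K H (T : hset K) : K \subset H ->
  has_op O T -> has_op O (hset_cosets H K) -> has_op O (hset_ind H T).
Proof.
move=> sKH [n [e [x [[e_inj e_lt e_surj] ex]]]] opHK.
have [r rK] := boolp.choice (@coset_ptP gT K H).
(* [c a] will be the factor of [a] in [K] relative to the representative of its coset. *)
have c_ex a : exists k : subg_of K, a = r (coset_pt K a) * subg_incl H k.
  by apply/(coset_pt_eq sKH); rewrite rK.
have [c cP] := boolp.choice c_ex.
have incl_inj : injective (@subg_incl gT K H).
  by move=> k l /(congr1 sgval); rewrite !subg_inclE // => /val_inj.
have cM a k : c (a * subg_incl H k) = c a * k.
  apply: incl_inj; rewrite subg_inclM //.
  apply: (@mulgI _ (r (coset_pt K a))); rewrite mulgA -cP.
  have e1 : coset_pt K a = coset_pt K (a * subg_incl H k).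
    by apply/esym/(coset_pt_eq sKH); exists k.
  by rewrite e1 -cP.
have [|phi phiE] := @ind_lift gT K H T _ (fun a _ => coset_pt K a).
  by move=> a k t; apply/(coset_pt_eq sKH); exists k.
(* Moving [(a, t)] to the chosen representative turns [t] into [c a] acting on [t], whose label is
   taken. *)
have [|eI eIE] := @ind_lift gT K H T _ (fun a t => e (hact T (c a) t)).
  by move=> a k t; rewrite cM hactM.
have ptE a t : ind_pt a t = ind_pt (r (coset_pt K a)) (hact T (c a) t).
  by rewrite -(ind_pt_eq sKH) -cP.
have cr A : c (r A) = 1.
  apply: incl_inj; apply: (@mulgI _ (r A)); rewrite -{1}(rK A) -cP.
  by rewrite subg_incl1 mulg1.
apply: (@has_op_fibration gT O H (hset_cosets H K) (hset_ind H T) phi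
  (fun=> n) eI (fun A => gact O (sgval (r A)) x)) => //.
- move=> h A; have [a [t ->]] := ind_ptP A.
  by rewrite hact_ind_pt !phiE hact_coset_pt.
- move=> A B; have [a [t ->]] := ind_ptP A; have [b [t' ->]] := ind_ptP B.
  by rewrite !phiE !eIE => eab /e_inj et; rewrite ptE et eab -ptE.
- by move=> A; have [a [t ->]] := ind_ptP A; rewrite eIE.
- move=> A i /e_surj[t <-]; exists (ind_pt (r A) t); first by rewrite phiE rK.
  by rewrite eIE cr hact1.
(* [h] carries the representative of [A] to that of [h A] times [k] in [K], and [x] is coherent for
   [k]. *)
move=> h A; pose k := c (h * r A).
have ek : h * r A = r (hact _ h A) * subg_incl H k.
  by rewrite [LHS]cP -hact_coset_pt rK.
have [s es st] := ex k; exists s.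
  rewrite -gactM -[sgval h * _]/(sgval (h * r A)) ek /=.
  by rewrite gactM subg_inclE // es gact_sact.
move=> B i; have [a [t ->]] := ind_ptP B; rewrite phiE hact_ind_pt !eIE => eA.
move=> /st ->; rewrite -hactM; congr (e (hact T _ t)); apply: incl_inj.
rewrite subg_inclM //; apply: (@mulgI _ (r (hact _ h A))).
by rewrite mulgA -ek -mulgA -eA -cP hact_coset_pt -cP.
Qed.

Lemma admissible_indexing : indexing_system (admissible O).
Proof.
split.
- by move=> H X; apply/admissibleP/has_op_triv.
- move=> H S T f f_bij f_eq /admissibleP opS.
  exact/admissibleP/(has_op_iso f_bij).
- by move=> H g T /admissibleP opT; apply/admissibleP/has_op_conj.
- by move=> K H sKH T /admissibleP opT; apply/admissibleP/has_op_res.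
- move=> H S T f f_inj f_eq /admissibleP opT.
  exact/admissibleP/(has_op_sub f_inj).
- by move=> H S T /admissibleP opS /admissibleP opT; apply/admissibleP/has_op_sum.
- move=> K H T sKH /admissibleP opT /admissibleP opHK.
  exact/admissibleP/has_op_ind.
Qed.

End AdmissibleIndexing.

(** * Fibrations in an indexing system *)

Definition hset_sig (gT : finGroupType) (H : {group gT}) (T : hset H)
  (P : pred T) (hP : forall h t, P t -> P (hact T h t)) : hset H.
Proof.
exists {t | P t}
  (fun h (t : {t : T | P t}) => exist (fun t => P t) (hact T h (sval t)) (hP h _ (svalP t))).
- by move=> t; apply: val_inj; rewrite /= hact1.
- by move=> a b t; apply: val_inj; rewrite /= hactM.
Defined.

Section IndexingFibration.
Variables (gT : finGroupType) (M : hclass gT).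
Hypothesis M_indexing : indexing_system M.
Implicit Types H K : {group gT}.

Lemma indexing_bij H (S T : hset H) (f : S -> T) :
  injective f -> (forall t, exists s, f s = t) -> equivariant f -> M S -> M T.
Proof.
move=> f_inj /boolp.choice[g gK]; apply: (is_iso M_indexing).
by exists g => // s; apply: f_inj; rewrite gK.
Qed.

Definition stab_pred H (S : hset H) (s : S) :=
  [set sgval k | k : subg_of H & hact S k s == s].
Arguments stab_pred {H} S s.

Lemma stab_group_set H (S : hset H) (s : S) : group_set (stab_pred S s).
Proof.
apply/group_setP; split.
  by apply/imsetP; exists 1 => //; rewrite inE hact1.
move=> _ _ /imsetP[a + ->] /imsetP[b + ->]; rewrite !inE => /eqP ea /eqP eb.
by apply/imsetP; exists (a * b); rewrite // inE hactM eb ea.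
Qed.

Definition hstab H (S : hset H) (s : S) : {group gT} := Group (@stab_group_set H S s).
Arguments hstab {H} S s.

Lemma hstabP H (S : hset H) s (h : subg_of H) :
  sgval h \in hstab S s <-> hact S h s = s.
Proof.
split=> [/imsetP[k + /val_inj ->]|e]; first by rewrite inE => /eqP.
by apply/imsetP; exists h; rewrite // inE e.
Qed.

Lemma hstab_sub H (S : hset H) s : hstab S s \subset H.
Proof. by apply/subsetP => _ /imsetP[k _ ->]; apply: subgP. Qed.

Lemma orbit_hact H (S : hset H) s k :
  hact S (subg_incl H (k : subg_of (hstab S s))) s = s.
Proof. by apply/hstabP; rewrite subg_inclE ?hstab_sub ?subgP. Qed.

(** The orbit of [s] is a copy of these cosets inside [S]. *)
Lemma indexing_cosets H (S : hset H) s : M S -> M (hset_cosets H (hstab S s)).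
Proof.
have sKH := @hstab_sub H S s; have [r rK] := boolp.choice (@coset_ptP gT (hstab S s) H).
have rE a : hact S (r (coset_pt (hstab S s) a)) s = hact S a s.
  have [k ek] : exists k : subg_of (hstab S s),
      a = r (coset_pt (hstab S s) a) * subg_incl H k.
    by apply/(coset_pt_eq sKH); rewrite rK.
  by rewrite [in RHS]ek hactM orbit_hact.
apply: (is_sub M_indexing (f := fun A => hact S (r A) s)) => [A B e|h A].
  rewrite -(rK A) -(rK B); apply/(coset_pt_eq sKH).
  have Kk : sgval ((r B)^-1 * r A) \in hstab S s.
    by apply/hstabP; rewrite hactM e -hactM mulVg hact1.
  exists (subg _ (sgval ((r B)^-1 * r A))).
  have -> : subg_incl H (subg (hstab S s) (sgval ((r B)^-1 * r A))) = (r B)^-1 * r A.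
    by apply: val_inj; rewrite [LHS]/= subg_inclE // subgK.
  by rewrite mulKVg.
by rewrite -{1}(rK A) hact_coset_pt rE hactM.
Qed.

(** [T] is the coproduct, over the orbits of [S], of sets induced up from a
    fibre and its stabilizer. *)
Lemma indexing_fibration H (S T : hset H) (phi : T -> S) :
  equivariant phi -> M S ->
  (forall s K (sKH : K \subset H), (forall h, sgval h \in K <-> hact S h s = s) ->
     forall (U : hset K) (f : U -> T), injective f ->
     (forall k u, f (hact U k u) = hact T (subg_incl H k) (f u)) ->
     (forall t, phi t = s <-> exists u, f u = t) -> M U) ->
  M T.
Proof.
(* Induction on the size of [S], splitting off one orbit at a time. *)
have [n] := ubnP #|S|.
elim: n S T phi => // n IH S T phi le_n phi_eq MS fib.
have [s|S0] := pickP S; last first.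
  have T0 (t : T) : False by have := S0 (phi t).
  apply: (indexing_bij (S := hset_triv H void) (f := fun x => match x with end)).
  - by case.
  - by move=> t; case: (T0 t).
  - by move=> h [].
  - exact: (is_triv M_indexing).
move=> _; have sKH := @hstab_sub H S s.
have fibP (k : subg_of (hstab S s)) t :
    phi t == s -> phi (hact (hset_res sKH T) k t) == s.
  by move=> /eqP e; rewrite /= phi_eq e orbit_hact.
pose U := @hset_sig _ _ (hset_res sKH T) (fun t => phi t == s) fibP.
have MU : M U.
  apply: (fib s _ sKH (@hstabP H S s) U sval) => [|//|t]; first exact: val_inj.
  split=> [/eqP e|[u <-]]; first by exists (exist _ t e).
  exact/eqP/(svalP u).
(* [P] cuts out the complement of the orbit of [s], to which the induction hypothesis applies. *)
pose P s' := ~~ [exists h : subg_of H, hact S h s == s'].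
have hP h s' : P s' -> P (hact S h s').
  apply: contra => /existsP[h' /eqP e]; apply/existsP; exists (h^-1 * h').
  by rewrite hactM e -hactM mulVg hact1.
have hPT h t : P (phi t) -> P (phi (hact T h t)) by rewrite phi_eq; apply: hP.
pose S' := @hset_sig _ _ S P hP; pose T' := @hset_sig _ _ T (fun t => P (phi t)) hPT.
pose phi' (t : T') : S' := exist (fun s => P s) (phi (sval t)) (svalP t).
have MT' : M T'.
  apply: (IH S' T' phi').
  - rewrite -ltnS; apply: leq_trans le_n; rewrite ltnS card_sig.
    apply: proper_card; apply/properP; split; first by apply/subsetP.
    exists s => //; rewrite inE /P negbK; apply/existsP; exists 1.
    by rewrite hact1.
  - by move=> h t; apply: val_inj; rewrite /= phi_eq.
  - by apply: (is_sub M_indexing (f := sval : S' -> S)) MS; [apply: val_inj|].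
  move=> s' K sKH' KP V f f_inj f_eq fP.
  apply: (fib (sval s') K sKH' _ V (fun v => sval (f v))).
  - by move=> h; rewrite KP; split=> [/(congr1 sval)//|e]; apply: val_inj.
  - by move=> u v /val_inj/f_inj.
  - by move=> k u; rewrite f_eq.
  move=> t; split=> [et|[v <-]].
    have Pt : P (phi t) by rewrite et; apply: (svalP s').
    have /fP[v ev] : phi' (exist _ t Pt) = s' by apply: val_inj.
    by exists v; rewrite ev.
  by have /(congr1 sval) : phi' (f v) = s' by apply/fP; exists v.
have [|F FE] := @ind_lift gT (hstab S s) H U T (fun a u => hact T a (sval u)).
  by move=> a k u; rewrite hactM.
have phiF a u : phi (hact T a (sval (u : U))) = hact S a s.
  by rewrite phi_eq (eqP (svalP u)).
pose Q (A : hset_sum (hset_ind H U) T') : T :=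
  match A with inl A => F A | inr t => sval t end.
apply: (@indexing_bij H (hset_sum (hset_ind H U) T') T Q).
- have clash A (t : T') : F A <> sval t.
    have [a [u ->]] := ind_ptP A; rewrite FE => e.
    have := svalP t; rewrite /= -e phiF /P => /negP[].
    by apply/existsP; exists a.
  move=> [A|t] [B|t'] //= => [e|/clash//|/esym/clash//|/val_inj->//].
  congr inl; have [a [u eA]] := ind_ptP A; have [b [v eB]] := ind_ptP B.
  move: e; rewrite {}eA {}eB !FE => e.
  have Kk : sgval (b^-1 * a) \in hstab S s.
    apply/hstabP; rewrite hactM -(phiF a u) e phiF.
    by rewrite -hactM mulVg hact1.
  pose k := subg (hstab S s) (sgval (b^-1 * a)).
  have ek : a = b * subg_incl H k.
    have -> : subg_incl H k = b^-1 * a.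
      by apply: val_inj; rewrite [LHS]subg_inclE // subgK.
    by rewrite mulKVg.
  rewrite ek ind_pt_eq //; suff -> : hact U k u = v by []; apply: val_inj => /=.
  by apply: (@hact_inj _ _ T b); rewrite -hactM -ek e.
- move=> t; have [Pt|] := boolP (P (phi t)); first by exists (inr (exist _ t Pt)).
  rewrite negbK => /existsP[h /eqP eh].
  have et : phi (hact T h^-1 t) == s.
    by rewrite phi_eq -eh -hactM mulVg hact1.
  exists (inl (ind_pt h (exist _ (hact T h^-1 t) et : U))).
  by rewrite /Q FE /= -hactM mulgV hact1.
- move=> h [A|t] //=; have [a [u ->]] := ind_ptP A.
  by rewrite [ind_act _ _](hact_ind_pt h a u) !FE hactM.
apply: (is_sum M_indexing) MT'; apply: (is_ind M_indexing) => //.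
exact: indexing_cosets.
Qed.

End IndexingFibration.
(** * A marked operad realizing a given indexing system *)

Section Trees.
Variable gT : finGroupType.

(** Trees with leaves labelled in the coinduced [G]-set [gT -> nat].  A node has
    one family of children for each element of a left coset [D]; the families
    are exchanged by the action.  [Blank] fills the entries outside [D] and those
    beyond the arity. *)
Inductive tree : Type :=
| Leaf (w : gT -> nat)
| Blank
| Node (D : {set gT}) (c : gT -> nat -> tree).

Definition shift (h : gT) (w : gT -> nat) : gT -> nat := fun a => w (h^-1 * a).

Fixpoint tree_act (h : gT) (x : tree) : tree :=
  match x with
  | Leaf w => Leaf (shift h w)
  | Blank => Blank
  | Node D c => Node (h *: D) (fun a i => tree_act h (c (h^-1 * a) i))
  end.

Fixpoint leaf (w : gT -> nat) (x : tree) : Prop :=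
  match x with
  | Leaf w' => w' = w
  | Blank => False
  | Node D c => exists a i, leaf w (c a i)
  end.

Lemma shift1 w : shift 1 w = w.
Proof. by apply/funext => a; rewrite /shift invg1 mul1g. Qed.

Lemma shiftM g h w : shift (g * h) w = shift g (shift h w).
Proof. by apply/funext => a; rewrite /shift invMg mulgA. Qed.

Lemma tree_act1 x : tree_act 1 x = x.
Proof.
elim: x => //= [w|D c IH]; first by rewrite shift1.
by rewrite lcoset1; congr Node; do 2 apply/funext => ?; rewrite invg1 mul1g.
Qed.

Lemma tree_actM g h x : tree_act (g * h) x = tree_act g (tree_act h x).
Proof.
elim: x => //= [w|D c IH]; first by rewrite shiftM.
by rewrite lcosetM; congr Node; do 2 apply/funext => ?; rewrite invMg -mulgA IH.
Qed.

Lemma tree_actK g : cancel (tree_act g) (tree_act g^-1).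
Proof. by move=> x; rewrite -tree_actM mulVg tree_act1. Qed.

Lemma tree_actKV g : cancel (tree_act g^-1) (tree_act g).
Proof. by move=> x; rewrite -tree_actM mulgV tree_act1. Qed.

Lemma leaf_act g w x : leaf w (tree_act g x) <-> leaf (shift g^-1 w) x.
Proof.
elim: x w => //= [w'|D c IH] w.
  by split=> [<-|->]; rewrite -shiftM ?mulVg ?mulgV shift1.
split=> [[a [i /IH]]|[a [i w_c]]]; first by exists (g^-1 * a), i.
by exists (g * a), i; apply/IH; rewrite mulKg.
Qed.

Section Good.
Variable M : hclass gT.
Hypothesis M_indexing : indexing_system M.

(** Whenever [H] fixes [x], the leaves of [x], presented as an [H]-set by [e],
    belong to [M H]. *)
Definition nice (x : tree) : Prop :=
  forall (H : {group gT}) (T : hset H) (e : T -> gT -> nat),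
    injective e -> (forall h t, e (hact T h t) = shift (sgval h) (e t)) ->
    (forall w, leaf w x <-> exists t, e t = w) ->
    (forall h : subg_of H, tree_act (sgval h) x = x) -> M T.

(** Conjugating back by [g^-1] returns to [H] only up to a propositional equality of groups;
    restriction followed by an isomorphism absorbs it. *)
Lemma indexing_of_conj (H : {group gT}) g (T : hset H) : M (hset_conj g T) -> M T.
Proof.
move=> MT; have sH : H \subset ((H :^ g) :^ g^-1)%G by rewrite /= conjsgK.
have := is_res M_indexing sH (is_conj M_indexing g^-1 MT).
apply: (@is_iso _ _ M_indexing H
  (hset_res sH (hset_conj g^-1 (hset_conj g T))) T (fun t => t)).
  by exists id.
move=> h t; rewrite /= /subg_conj /subg_incl; congr (hact T _ t).
apply: val_inj; rewrite /= invgK.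
have Hh := subgP h; have Hhg : sgval h ^ g \in (H :^ g)%G by rewrite memJ_conjg.
have e1 : sgval (subg ((H :^ g) :^ g^-1)%G (sgval h)) = sgval h.
  by rewrite subgK // (subsetP sH).
have e2 : sgval (subg (H :^ g)%G (sgval h ^ g)) = sgval h ^ g by rewrite subgK.
by rewrite e1 e2 conjgK subgK.
Qed.

(** If [H] fixes [tree_act g x], then [H :^ g] fixes [x], and the leaves correspond under the shift
    by [g^-1]. *)
Lemma nice_act g x : nice x -> nice (tree_act g x).
Proof.
move=> x_nice H T e e_inj e_eq e_leaf x_fix; apply: (@indexing_of_conj _ g).
apply: (x_nice (H :^ g)%G (hset_conj g T) (fun t : T => shift g^-1 (e t))).
- by move=> t t' /(congr1 (shift g)); rewrite -!shiftM mulgV !shift1 => /e_inj.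
- move=> h t /=; rewrite e_eq -!shiftM; congr (shift _ (e t)).
  by rewrite subgK -?mem_conjg ?subgP // conjgE invgK mulKg.
- move=> w; split=> [w_x|[t <-]].
    have /e_leaf[t et] : leaf (shift g w) (tree_act g x).
      by apply/leaf_act; rewrite -shiftM mulVg shift1.
    by exists t; rewrite et -shiftM mulVg shift1.
  by apply/leaf_act/e_leaf; exists t.
move=> h; have := x_fix (subg_conj h).
rewrite subgK -?mem_conjg ?subgP // conjgE invgK => /(congr1 (tree_act g^-1)).
by rewrite -!tree_actM mulKg -mulgA mulVg mulg1 tree_act1.
Qed.

(** The set of leaves is a single point, necessarily with trivial action. *)
Lemma nice_leaf w : nice (Leaf w).
Proof.
move=> H T e e_inj _ e_leaf _; have [t0 et0] := (e_leaf w).1 erefl.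
have eT t : t = t0 by apply: e_inj; rewrite et0; apply/esym/e_leaf; exists t.
apply: (indexing_bij M_indexing (S := hset_triv H unit) (f := fun=> t0)).
- by move=> [] [].
- by move=> t; exists tt.
- by move=> h t; rewrite (eT (hact _ _ _)).
- exact: (is_triv M_indexing).
Qed.

(** Unlike admissibility of the graph subgroups fixing [f], this property is
    visibly stable under operadic composition. *)
Definition good n (f : ('I_n -> tree) -> tree) : Prop :=
  forall z : 'I_n -> tree, (forall i, nice (z i)) ->
    (forall i j w, leaf w (z i) -> leaf w (z j) -> i = j) ->
    nice (f z) /\ forall w, leaf w (f z) <-> exists i, leaf w (z i).

(** The coset [gs_dom Gam] of a fixed node forces the group fixing it into
    [gs_dom Gam], where its action on the children is the one given by [Gam]. *)
Definition norm_child n (Gam : graph_subgroup gT n) (z : 'I_n -> tree) a i : tree :=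
  if a \in gs_dom Gam then
    if insub i is Some j then z (gs_map Gam (subg (gs_dom Gam) a) j) else Blank
  else Blank.

Definition norm_op n (Gam : graph_subgroup gT n) (z : 'I_n -> tree) : tree :=
  Node (gs_dom Gam) (norm_child Gam z).

Lemma norm_childE n (Gam : graph_subgroup gT n) z (h : subg_of (gs_dom Gam))
    (i : 'I_n) :
  norm_child Gam z (sgval h) i = z (gs_map Gam h i).
Proof. by rewrite /norm_child subgP valK sgvalK. Qed.

Lemma norm_good n (Gam : graph_subgroup gT n) :
  M (gs_hset Gam) -> good (norm_op Gam).
Proof.
move=> MGam z z_nice z_disj.
have leafP w : leaf w (norm_op Gam z) <-> exists i, leaf w (z i).
  split=> [[a [i]]|[i w_z]]; last first.
    by exists (sgval (1 : subg_of (gs_dom Gam))), i; rewrite norm_childE gs_map1.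
  rewrite /norm_child; case: ifP => // _; case: insubP => //= j _ _.
  by exists (gs_map Gam (subg (gs_dom Gam) a) j).
split=> // H T e e_inj e_eq e_leaf x_fix.
have sHD : H \subset gs_dom Gam.
  apply/subsetP => h Hh; have [eD _] := x_fix (subg H h).
  by rewrite -eD subgK // -[in X in X \in _](mulg1 h) mem_lcoset mulKg group1.
(* Compare the children of the fixed node at index [h]: on the translated side this is the child at
   [h^-1 * h = 1]. *)
have zE (h : subg_of H) i : tree_act (sgval h) (z i) = z (gs_map Gam (subg_incl _ h) i).
  have [_ /(congr1 (fun c => c (sgval h) (val i)))] := x_fix h.
  rewrite mulVg -(subg_inclE h sHD) norm_childE => <-.
  have -> : 1 = sgval (1 : subg_of (gs_dom Gam)) by [].
  by rewrite norm_childE gs_map1.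
(* [phi] sends a leaf to the input containing it; disjointness makes it equivariant. *)
have phi_ex t : exists i, leaf (e t) (z i).
  by apply/leafP/e_leaf; exists t.
have [phi phiP] := boolp.choice phi_ex.
apply: (@indexing_fibration _ _ M_indexing H (hset_res sHD (gs_hset Gam)) T phi).
- move=> h t; apply: (z_disj _ _ (e (hact T h t))) => //=.
  by rewrite -zE leaf_act e_eq -shiftM mulVg shift1.
- exact: is_res.
(* The stabilizer [K] of [i] fixes [z i], whose leaves form the fibre over [i], so niceness of [z i]
   applies. *)
move=> i K sKH KP U f f_inj f_eq fP.
apply: (z_nice i K U (e \o f)).
- exact: inj_comp.
- by move=> k u; rewrite /= f_eq e_eq subg_inclE.
- move=> w; split=> [w_z|[u <-]].
    have /e_leaf[t et] : leaf w (norm_op Gam z) by apply/leafP; exists i.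
    have /fP[u eu] : phi t = i by apply: (z_disj _ _ w); rewrite // -et.
    by exists u; rewrite /= eu.
  have <- : phi (f u) = i by apply/fP; exists u.
  exact: phiP.
move=> k; rewrite -(subg_inclE k sKH) zE; congr z.
by apply/KP; rewrite subg_inclE ?subgP.
Qed.

End Good.
End Trees.

(** * Positions in concatenated blocks *)

Section BlockRanks.
Local Open Scope nat_scope.

Lemma Rank_const1 n (i : 'I_n) (j : 'I_1) :
  tagnat.Rank (p_ := fun=> 1) i j = i :> nat.
Proof.
rewrite tagnat.RankEsum ord1 addn0 -(big_ord_widen _ (fun=> 1)) 1?ltnW //.
by rewrite sum1_card card_ord.
Qed.

Lemma Rank_single n (i : 'I_1) (j : 'I_n) :
  tagnat.Rank (p_ := fun=> n) i j = j :> nat.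
Proof. by rewrite tagnat.RankEsum big_pred0 // => k; rewrite !ord1. Qed.

Lemma ltn_Rank k (m : 'I_k -> nat) i i' (j : 'I_(m i)) (j' : 'I_(m i')) :
  (tagnat.Rank i j < tagnat.Rank i' j') = (i < i') || (i == i') && (j < j').
Proof.
have H a b (x : 'I_(m a)) (y : 'I_(m b)) : a < b -> tagnat.Rank a x < tagnat.Rank b y.
  move=> ab; rewrite !tagnat.RankEsum ltn_addr //.
  rewrite [ltnRHS](bigID (fun c : 'I_k => c < a)) /=.
  rewrite [X in _ < X + _](eq_bigl (fun c : 'I_k => c < a)); last first.
    by move=> c /=; case: (ltnP c a); rewrite ?andbF // => /ltn_trans->.
  by rewrite ltn_add2l (bigD1 a) /= ?ab ?ltnn // ltn_addr.
have [lt_ii'|lt_i'i|/val_inj eii'] := ltngtP i i'; first exact: H.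
  rewrite -val_eqE /= (gtn_eqF lt_i'i) /=.
  by apply/negbTE; rewrite -leqNgt ltnW ?H.
by case: _ / eii' in j' *; rewrite eqxx !tagnat.RankEsum ltn_add2l.
Qed.

(** Both sides add up the sizes [m] at the indices preceding [a], and [Rank] is lexicographic by
    [ltn_Rank]. *)
Lemma Rank_Rank k (n : 'I_k -> nat) (m : forall i, 'I_(n i) -> nat)
    (a : 'I_(\sum_i n i)) (l : 'I_(m (tagnat.sig1 a) (tagnat.sig2 a))) :
  tagnat.Rank (p_ := fun a => m (tagnat.sig1 a) (tagnat.sig2 a)) a l =
  tagnat.Rank (p_ := fun i => \sum_j m i j) (tagnat.sig1 a)
    (tagnat.Rank (tagnat.sig2 a) l) :> nat.
Proof.
rewrite !tagnat.RankEsum addnA; congr (_ + _).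
set i0 := tagnat.sig1 a; set j0 := tagnat.sig2 a.
have aE : a = tagnat.Rank i0 j0 by rewrite tagnat.sig2K.
transitivity (\sum_(i < k) \sum_(j < n i | tagnat.Rank i j < a) m i j).
  rewrite (reindex_onto (@tagnat.rank k n) tagnat.sig) /=; last first.
    by move=> b _; apply: tagnat.sigK.
  rewrite sig_big_dep /=; apply: eq_big => [[i j]|p _].
    by rewrite tagnat.rankK eqxx andbT.
  by rewrite /tagnat.sig1 /tagnat.sig2 tagnat.rankK.
(* Blocks before [i0] count in full, block [i0] up to [j0], and later blocks not at all. *)
rewrite (bigID (fun i : 'I_k => i < i0)) /=; congr (_ + _).
  apply: eq_bigr => i lt_i; apply: eq_bigl => j.
  by rewrite aE ltn_Rank lt_i.
rewrite (bigD1 i0) ?ltnn //= [X in _ + X]big1 ?addn0 => [|i /andP[]].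
  by apply: eq_bigl => j; rewrite aE ltn_Rank ltnn eqxx.
rewrite -leqNgt leq_eqVlt => /orP[/eqP/val_inj->|lt_i]; first by rewrite eqxx.
move=> ne; rewrite big_pred0 // => j; rewrite aE ltn_Rank (negPf ne).
by rewrite ltnNge ltnW.
Qed.

(** [a] is compared with a rank as a number because the sums bounding them are equal but not
    convertible. *)
Lemma block_permE k (m : 'I_k -> nat) (s : 'S_k) i
    (j : 'I_(m (s i))) (a : 'I_(\sum_i m i)) :
  tagnat.Rank (p_ := fun i => m (s i)) i j = a :> nat ->
  block_perm m s a = tagnat.Rank (s i) j.
Proof.
move=> ea; rewrite permE /block_perm_fun.
have -> : cast_ord (sum_perm m s) a = tagnat.Rank i j by apply: val_inj.
exact: (sig_Rank (fun i j => tagnat.Rank (p_ := m) (s i) j) j).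
Qed.

Lemma sum_permsE k (m : 'I_k -> nat) (t : forall i, 'S_(m i)) i j :
  sum_perms t (tagnat.Rank i j) = tagnat.Rank i (t i j).
Proof.
by rewrite permE /sum_perm_fun (sig_Rank (fun i j => tagnat.Rank i (t i j))).
Qed.

End BlockRanks.

(** * The marked operad of good functions *)

Section GoodOperad.
Variables (gT : finGroupType) (M : hclass gT).
Hypothesis M_indexing : indexing_system M.
Let tree := tree gT.

Definition good_car n : Type := {f : ('I_n -> tree) -> tree | good M f}.

Lemma good_car_eq n (f f' : good_car n) : sval f =1 sval f' -> f = f'.
Proof.
by case: f f' => f fP [f' f'P] /= /funext e; case: _ / e f'P => f'P; apply: eq_exist.
Qed.

Lemma good_gact n g (f : good_car n) :
  good M (fun z => tree_act g (sval f (fun i => tree_act g^-1 (z i)))).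
Proof.
move=> z z_nice z_disj.
have [|i j w|f_nice f_leaf] := svalP f (fun i => tree_act g^-1 (z i)).
- by move=> i; apply: nice_act.
- by rewrite !leaf_act; apply: z_disj.
split; first exact: nice_act.
move=> w; rewrite leaf_act f_leaf; split=> -[i w_i]; exists i; move: w_i;
  by rewrite leaf_act -shiftM mulVg shift1.
Qed.

Lemma good_sact n (s : 'S_n) (f : good_car n) :
  good M (fun z => sval f (fun i => z (s^-1 i))).
Proof.
move=> z z_nice z_disj.
have [//|i j w|f_nice f_leaf] := svalP f (fun i => z (s^-1 i)).
  by move=> wi wj; apply: perm_inj (z_disj _ _ _ wi wj).
split=> // w; rewrite f_leaf; split=> -[i w_i]; first by exists (s^-1 i).
by exists (s i); rewrite permK.
Qed.

Lemma good_id : good M (fun z : 'I_1 -> tree => z ord0).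
Proof.
move=> z z_nice _; split=> // w; split=> [w_z|[i]]; first by exists ord0.
by rewrite ord1.
Qed.

Lemma good_comp k (n : 'I_k -> nat) (f : good_car k) (y : forall i, good_car (n i)) :
  good M (fun z => sval f (fun i => sval (y i) (fun j => z (tagnat.Rank i j)))).
Proof.
move=> z z_nice z_disj.
have yP i : nice M (sval (y i) (fun j => z (tagnat.Rank i j))) /\
    forall w, leaf w (sval (y i) (fun j => z (tagnat.Rank i j))) <->
      exists j, leaf w (z (tagnat.Rank i j)).
  apply: (svalP (y i)) => // j j' w wj wj'.
  have /(congr1 val)/eqP := z_disj _ _ _ wj wj'.
  by rewrite tagnat.eq_Rank eqxx => /eqP/val_inj.
have [|i i' w|f_nice f_leaf] :=
    svalP f (fun i => sval (y i) (fun j => z (tagnat.Rank i j))).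
- by move=> i; have [] := yP i.
- move=> /(yP i).2[j wj] /(yP i').2[j' wj'].
  have /(congr1 val)/eqP := z_disj _ _ _ wj wj'.
  by rewrite tagnat.eq_Rank => /andP[/eqP].
split=> // w; rewrite f_leaf; split=> [[i /(yP i).2[j wj]]|[a wa]].
  by exists (tagnat.Rank i j).
exists (tagnat.sig1 a); apply/(yP _).2; exists (tagnat.sig2 a).
by rewrite tagnat.sig2K.
Qed.

Definition good_seq : gsymseq gT.
Proof.
exists good_car (fun n g f => exist _ _ (good_gact g f))
  (fun n f s => exist _ _ (good_sact s f)) => n.
- move=> f; apply: good_car_eq => z /=; rewrite tree_act1 invg1.
  by congr (sval f); apply/funext => i; rewrite tree_act1.
- move=> g h f; apply: good_car_eq => z /=; rewrite tree_actM invMg.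
  by congr (tree_act g (tree_act h (sval f _))); apply/funext => i; rewrite tree_actM.
- move=> f; apply: good_car_eq => z /=; congr (sval f).
  by apply/funext => i; rewrite invg1 perm1.
- move=> f s t; apply: good_car_eq => z /=; congr (sval f).
  by apply/funext => i; rewrite invMg permM.
- by move=> g f s; apply: eq_exist.
Defined.

(** Inputs indexed by [nat] can be fed to both functions, whose arities need not be convertible. *)
Lemma good_tagged n m (f : good_car n) (f' : good_car m) : n = m ->
  (forall z : nat -> tree, sval f (fun i => z i) = sval f' (fun i => z i)) ->
  Tagged good_car f = Tagged good_car f'.
Proof.
move=> enm; case: _ / enm f' => f' eff'; congr Tagged.
apply: good_car_eq => z.
pose z' i := if insub i is Some j then z j else Blank gT.
have -> : z = fun i : 'I_n => z' i by apply/funext => i; rewrite /z' valK.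
exact: eff'.
Qed.

(** Only their arities matter: through [teq_tag] these terms give the equalities
    of arities behind the operad axioms. *)
Definition arity_term n : term gT (fun=> unit) n := TGen tt.
Definition no_rel n (t t' : term gT (fun=> unit) n) := False.

Definition good_op_id : good_seq 1%N := exist _ _ good_id.

Definition good_op_comp k (n : 'I_k -> nat) (f : good_seq k)
    (y : forall i, good_seq (n i)) : good_seq (\sum_i n i)%N :=
  exist _ _ (good_comp f y).

Lemma good_compE k (n : 'I_k -> nat) (f : good_seq k)
    (y : forall i, good_seq (n i)) z :
  sval (good_op_comp f y) z =
  sval f (fun i => sval (y i) (fun j => z (tagnat.Rank i j))).
Proof. by []. Qed.

Lemma good_gactE n g (f : good_seq n) z :
  sval (gact good_seq g f) z = tree_act g (sval f (fun i => tree_act g^-1 (z i))).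
Proof. by []. Qed.

Lemma good_sactE n s (f : good_seq n) z :
  sval (sact good_seq f s) z = sval f (fun i => z (s^-1 i)).
Proof. by []. Qed.

Definition good_operad : operad gT.
Proof.
exists good_seq good_op_id good_op_comp.
- move=> n y; apply: good_tagged => [|z].
    exact: (teq_tag (teq_idl no_rel (arity_term n))).
  rewrite good_compE.
  change (sval y (fun j => z (tagnat.Rank (p_ := fun _ : 'I_1 => n) ord0 j)) =
    sval y (fun i => z i)).
  by congr (sval y); apply/funext => i; rewrite Rank_single.
- move=> k x; apply: good_tagged => [|z].
    exact: (teq_tag (teq_idr no_rel (arity_term k))).
  rewrite good_compE; congr (sval x); apply/funext => i.
  change (z (tagnat.Rank (p_ := fun _ : 'I_k => 1%N) i ord0) = z i).
  by rewrite Rank_const1.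
- move=> k n m x y z; apply: good_tagged => [|w].
    exact: (teq_tag (teq_assoc no_rel (arity_term k) (fun i => arity_term (n i))
      (fun i j => arity_term (m i j)))).
  rewrite !good_compE; congr (sval x); apply/funext => i.
  rewrite good_compE; congr (sval (y i)); apply/funext => j.
  (* [F] abstracts block and position together, so that [sig_Rank] applies. *)
  pose F i (j : 'I_(n i)) := sval (z i j)
    (fun l => w (tagnat.Rank (p_ := fun i => (\sum_j m i j)%N) i (tagnat.Rank j l))).
  rewrite -[RHS]/(F i j) -[RHS](sig_Rank F); congr (sval (z _ _)).
  by apply/funext => l; rewrite Rank_Rank.
- move=> k m s x y; apply: good_tagged => [|w].
    exact: (teq_tag (teq_sactl no_rel s (arity_term k) (fun i => arity_term (m i)))).
  rewrite good_compE !good_sactE good_compE; congr (sval x); apply/funext => i.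
  pose F i := sval (y i) (fun j => w ((block_perm m s)^-1 (tagnat.Rank i j))).
  rewrite -[RHS]/(F i) -[in RHS](permKV s i) /F.
  congr (sval (y _)); apply/funext => j; congr w.
  pose a := cast_ord (esym (sum_perm m s))
    (tagnat.Rank (p_ := fun i => m (s i)) (s^-1 i) j).
  by rewrite -(@block_permE _ _ _ _ _ a) // permK.
- move=> k n t x y; apply: good_car_eq => z.
  rewrite good_sactE !good_compE.
  congr (sval x); apply/funext => i.
  rewrite good_sactE; congr (sval (y i)); apply/funext => j.
  congr z; apply: (@perm_inj _ (sum_perms t)).
  by rewrite permKV sum_permsE permKV.
- by move=> g; apply: good_car_eq => z; apply: tree_actKV.
- move=> g k n x y; apply: good_car_eq => z.
  rewrite good_gactE !good_compE good_gactE.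
  congr (tree_act g (sval x _)); apply/funext => i.
  by rewrite good_gactE tree_actK.
Defined.

(** The coset is unchanged as [h] lies in the group, and reading the children at [h^-1 * a] permutes
    the inputs by the inverse of [gs_map Gam h]. *)
Lemma norm_fixed n (Gam : graph_subgroup gT n) (MGam : M (gs_hset Gam))
    (h : subg_of (gs_dom Gam)) :
  let f : good_operad n := exist _ _ (norm_good M_indexing MGam) in
  gact good_operad (sgval h) f = sact good_operad f (gs_map Gam h).
Proof.
apply: good_car_eq => z /=; rewrite /norm_op; congr Node.
  by rewrite lcoset_id ?subgP.
apply/funext => a; apply/funext => i; rewrite /norm_child groupMl ?groupV ?subgP //.
case: ifP => // Da; case: insubP => //= j _ _; rewrite tree_actKV; congr z.
apply: (@perm_inj _ (gs_map Gam h)); rewrite permKV -gs_mapM; congr (gs_map Gam _ j).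
apply: val_inj; rewrite /= !subgK ?groupM ?groupV ?subgP //; by rewrite mulKVg.
Qed.

(** Its nodes are fixed by all of [G]; arities 0 and 2 provide the markings. *)
Definition trivial_gs n : graph_subgroup gT n.
Proof. by exists [set: gT]%G (fun=> 1) => h k i; rewrite !perm1. Defined.

Lemma trivial_gs_indexing n : M (gs_hset (trivial_gs n)).
Proof.
apply: (@indexing_bij _ _ M_indexing _ (hset_triv _ 'I_n)
  (gs_hset (trivial_gs n)) (fun i => i)) => //.
- by move=> i; exists i.
- by move=> h i; rewrite /= perm1.
- exact: (is_triv M_indexing).
Qed.

Lemma trivial_gs_fixed n g
    (f := exist _ _ (norm_good M_indexing (trivial_gs_indexing n))) :
  gact good_operad g (f : good_operad n) = f.
Proof.
have := norm_fixed (trivial_gs_indexing n) (subg [set: gT]%G g).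
by rewrite subgK ?inE // => ->; apply: (@sact1 _ good_seq).
Qed.

Definition good_marked : marked_operad gT :=
  MarkedOperad (@trivial_gs_fixed 0) (@trivial_gs_fixed 2).

(** The unit of coinduction: an injective [H]-map from [T] to the labels.  The
    successor keeps the values on [H] apart from the default [0]. *)
Definition generic_leaf (H : {group gT}) (T : hset H) (t : T) : gT -> nat :=
  fun a => if a \in H then (enum_rank (hact T (subg H a^-1) t)).+1 else 0%N.

Lemma generic_leaf_inj (H : {group gT}) (T : hset H) : injective (@generic_leaf H T).
Proof.
move=> t t' /(congr1 (fun w => w 1)); rewrite /generic_leaf group1 invg1 subg1.
by rewrite !hact1 => -[] /val_inj/enum_rank_inj.
Qed.

Lemma generic_leaf_hact (H : {group gT}) (T : hset H) h t :
  generic_leaf (hact T h t) = shift (sgval h) (generic_leaf t).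
Proof.
apply/funext => a; rewrite /shift /generic_leaf groupMl ?groupV ?subgP //.
case: ifP => // Ha; rewrite -hactM; congr (enum_rank (hact T _ t)).+1.
by apply: val_inj; rewrite /= invMg invgK !subgK ?groupM ?groupV ?subgP.
Qed.

Lemma admissible_good (H : {group gT}) (T : hset H) :
  admissible good_marked T <-> M T.
Proof.
split=> [[x x_fix]|MT]; last first.
  have MGam : M (gs_hset (hset_graph T)).
    apply: (is_iso M_indexing (f := enum_rank : T -> gs_hset (hset_graph T))) MT.
      exact: enum_rank_bij.
    by move=> h t; rewrite /= permE /hset_perm_fun enum_rankK.
  exists (exist _ _ (norm_good M_indexing MGam)) => h.
  apply/gsact_fixE; exact: norm_fixed.
pose z (i : 'I_#|T|) := Leaf (generic_leaf (enum_val i : T)).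
have [i|i j w|fz_nice fz_leaf] := svalP x z.
- exact: nice_leaf.
- by move=> /= <- /generic_leaf_inj/enum_val_inj.
apply: (fz_nice H T (@generic_leaf H T)).
- exact: generic_leaf_inj.
- exact: generic_leaf_hact.
- move=> w; rewrite fz_leaf; split=> [[i <-]|[t <-]]; first by exists (enum_val i).
  by exists (enum_rank t); rewrite /= enum_rankK.
move=> h; have /gsact_fixE e := x_fix h.
have zE j : tree_act (sgval h) (z j) = z (gs_map (hset_graph T) h j).
  by rewrite /z permE enum_rankK /= -generic_leaf_hact.
(* Evaluate the fixed-point equation at the translated leaves: the left side is the translate of the
   tree, and on the right the permutation undoes the translation. *)
have := congr1 (fun f : good_car _ => sval f (fun i => tree_act (sgval h) (z i))) e.
rewrite good_gactE good_sactE.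
have -> : (fun i => tree_act (sgval h)^-1 (tree_act (sgval h) (z i))) = z.
  by apply/funext => i; rewrite tree_actK.
by move=> ->; congr (sval x); apply/funext => i; rewrite zE permKV.
Qed.

End GoodOperad.
(** * Maps out of cofibrant operads *)

Section Product.
Variables (gT : finGroupType) (O P : marked_operad gT).

Definition prod_seq : gsymseq gT.
Proof.
exists (fun n => O n * P n)%type (fun n g x => (gact O g x.1, gact P g x.2))
  (fun n x s => (sact O x.1 s, sact P x.2 s)) => n.
- by case=> x y; rewrite !gact1.
- by move=> g h [x y]; rewrite !gactM.
- by case=> x y; rewrite !sact1.
- by move=> [x y] s t; rewrite !sactM.
- by move=> g [x y] s; rewrite !gact_sact.
Defined.

Lemma prod_tagged n m (x : prod_seq n) (x' : prod_seq m) :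
  Tagged O x.1 = Tagged O x'.1 -> Tagged P x.2 = Tagged P x'.2 ->
  Tagged prod_seq x = Tagged prod_seq x'.
Proof.
case: x x' => x y [x' y'] /= ex; have /= enm := congr1 tag ex.
case: _ / enm x' ex y' => x' ex y' ey.
by rewrite (eq_from_Tagged ex) (eq_from_Tagged ey).
Qed.

Definition prod_operad : operad gT.
Proof.
exists prod_seq (op_id O, op_id P) (fun k n x y =>
  (op_comp O x.1 (fun i => (y i).1), op_comp P x.2 (fun i => (y i).2))).
- by move=> n y; apply: prod_tagged; apply: op_idl.
- by move=> k x; apply: prod_tagged; apply: op_idr.
- move=> k n m x y z; apply: prod_tagged => /=.
    exact: (op_assoc _ _ (fun i j => (z i j).1)).
  exact: (op_assoc _ _ (fun i j => (z i j).2)).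
- move=> k m s x y; apply: prod_tagged => /=.
    exact: (op_sactl s _ (fun i => (y i).1)).
  exact: (op_sactl s _ (fun i => (y i).2)).
- by move=> k n t x y /=; rewrite !op_sactr.
- by move=> g /=; rewrite !op_gid.
- by move=> g k n x y /=; rewrite !op_gcomp.
Defined.

Definition prod_marked : marked_operad gT.
Proof.
exists prod_operad (mark_u O, mark_u P) (mark_p O, mark_p P) => g /=.
  by rewrite !gact_mark_u.
by rewrite !gact_mark_p.
Defined.

Definition prod_fst : marked_hom prod_marked O.
Proof.
by exists (@SeqHom gT prod_seq O (fun n x => x.1)
  (fun _ _ _ => erefl) (fun _ _ _ => erefl)).
Defined.

Definition prod_snd : marked_hom prod_marked P.
Proof.
by exists (@SeqHom gT prod_seq P (fun n x => x.2)
  (fun _ _ _ => erefl) (fun _ _ _ => erefl)).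
Defined.

End Product.

(** * Orbits represent fixed points *)

Section OrbitHom.
Variables (gT : finGroupType) (n : nat) (Gam : graph_subgroup gT n).

Lemma orbit_base_pred : orbit_pred Gam (gs_coset Gam 1 [ffun i : 'I_n => i]).
Proof.
apply/existsP; exists 1; apply/existsP; exists [ffun i => i].
by rewrite !eqxx andbT; apply/injectiveP => i j; rewrite !ffunE.
Qed.

Definition orbit_base : orbit_seq Gam n :=
  exist (fun A => orbit_pred Gam A) _ orbit_base_pred.

Lemma gsact_baseE g (t : 'S_n) :
  sval (gsact g t orbit_base) = gs_coset Gam g [ffun i => t i].
Proof.
rewrite /gsact /= /orbit_mul -!imset_comp; apply: eq_imset => h /=.
rewrite !mul1g; congr pair; apply/ffunP => i.
by rewrite !ffunE invgK perm1.
Qed.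

Lemma orbit_generated m (a : orbit_seq Gam m) :
  exists g t, Tagged (orbit_seq Gam) a = Tagged (orbit_seq Gam) (gsact g t orbit_base).
Proof.
have /existsP[g /existsP[s /and3P[/eqP em /injectiveP s_inj /eqP ea]]] := svalP a.
case: _ / (esym em) in a s s_inj ea *; exists g, (perm s_inj); congr Tagged.
apply: val_inj; rewrite [RHS]gsact_baseE [LHS]ea; congr gs_coset.
by apply/ffunP => i; rewrite ffunE permE.
Qed.

(** The stabilizer of the base point is no larger than [Gam]; this makes [orbit_rel]
    single-valued. *)
Lemma gsact_base_eq g g' (t t' : 'S_n) :
  gsact g t orbit_base = gsact g' t' orbit_base ->
  exists h : subg_of (gs_dom Gam), g = g' * sgval h /\ t = gs_map Gam h * t'.
Proof.
move=> /(congr1 sval); rewrite !gsact_baseE => e.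
have : (g, [ffun i => t i]) \in gs_coset Gam g' [ffun i => t' i].
  rewrite -e; apply/imsetP; exists 1; rewrite // mulg1; congr pair.
  by apply/ffunP => i; rewrite !ffunE gs_map1.
case/imsetP=> h _ [-> /ffunP et]; exists h; split=> //.
by apply/permP => i; have := et i; rewrite !ffunE permM.
Qed.

Lemma gsactM (X : gsymseq gT) m g h (s t : 'S_m) (x : X m) :
  gsact g s (gsact h t x) = gsact (g * h) (t * s) x.
Proof. by rewrite /gsact gact_sact -sactM gactM invMg. Qed.

Lemma gsact_hom (X Y : gsymseq gT) (f : seq_hom X Y) m g (s : 'S_m) (x : X m) :
  f m (gsact g s x) = gsact g s (f m x).
Proof. by rewrite /gsact seq_hom_sact seq_hom_gact. Qed.

Lemma orbit_base_fixed : gs_fixed Gam orbit_base.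
Proof.
move=> h; apply: val_inj; rewrite [LHS]gsact_baseE /=.
apply/setP => -[g s]; apply/imsetP/imsetP => -[k _ [-> ->]].
  exists (h * k) => //; congr pair; first by rewrite mul1g.
  by apply/ffunP => i; rewrite !ffunE gs_mapM.
exists (h^-1 * k) => //; congr pair; first by rewrite mul1g mulKVg.
by apply/ffunP => i; rewrite !ffunE -gs_mapM mulKVg.
Qed.

Variables (X : gsymseq gT) (x : X n).
Hypothesis x_fixed : gs_fixed Gam x.

(** The graph of the map sending the base point to [x]. Tags are needed as [m] equals [n] only
    propositionally. *)
Definition orbit_rel m (a : orbit_seq Gam m) (z : X m) : Prop :=
  exists g t, Tagged (orbit_seq Gam) a = Tagged (orbit_seq Gam) (gsact g t orbit_base)
    /\ Tagged X z = Tagged X (gsact g t x).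

Lemma orbit_rel_ex m (a : orbit_seq Gam m) : exists z, orbit_rel a z.
Proof.
have [g [t e]] := orbit_generated a; have /= enm := congr1 tag e.
case: _ / (esym enm) in a e *; exists (gsact g t x), g, t; split=> //.
Qed.

Lemma orbit_rel_uniq m (a : orbit_seq Gam m) z z' :
  orbit_rel a z -> orbit_rel a z' -> z = z'.
Proof.
move=> [g [t [ea ez]]] [g' [t' [ea' ez']]].
apply: (eq_from_Tagged (T_ := X)); rewrite ez ez'; congr Tagged.
move: ea'; rewrite ea => e.
have [h [-> ->]] := gsact_base_eq (eq_from_Tagged e).
by rewrite -gsactM x_fixed.
Qed.

Lemma orbit_rel_gsact m (a : orbit_seq Gam m) z h (s : 'S_m) :
  orbit_rel a z -> orbit_rel (gsact h s a) (gsact h s z).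
Proof.
move=> [g [t [ea ez]]]; have /= enm := congr1 tag ea.
case: _ / (esym enm) in a z s ea ez *; exists (h * g), (t * s).
rewrite -!gsactM; split.
  by rewrite (eq_from_Tagged ea).
by rewrite (eq_from_Tagged ez).
Qed.

Lemma orbit_hom_ex : exists f : seq_hom (orbit_seq Gam) X, f n orbit_base = x.
Proof.
pose f m (a : orbit_seq Gam m) := sval (cid (orbit_rel_ex a)).
have fP m a : orbit_rel a (f m a) := svalP (cid (orbit_rel_ex a)).
have fgs m a g (s : 'S_m) : f m (gsact g s a) = gsact g s (f m a).
  by apply: (orbit_rel_uniq (fP _ _)); apply: orbit_rel_gsact.
unshelve eexists.
  exists f => m.
    by move=> g a; have := fgs m a g 1; rewrite /gsact invg1 !sact1.
  by move=> a s; have := fgs m a 1 s^-1; rewrite /gsact invgK !gact1.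
apply: (orbit_rel_uniq (fP _ _)); exists 1, 1.
by rewrite /gsact invg1 !sact1 !gact1.
Qed.

End OrbitHom.

(** By adjunction, a morphism out of [F_+] of the orbit is an operation fixed by [Gam];
    compatibility on the source of the generating cofibration is automatic by initiality. *)
Lemma acyclic_fibration_fixed (gT : finGroupType) (X Y : marked_operad gT)
    (p : marked_hom X Y) :
  (forall n (Gam : graph_subgroup gT n) y, gs_fixed Gam y ->
     exists2 x : X n, gs_fixed Gam x & p n x = y) ->
  acyclic_fibration p.
Proof.
move=> p_lift n Gam a b _.
have [h|x x_fix ex] := p_lift n Gam (b n (Fplus_unit _ n (orbit_base Gam))).
  by rewrite -!gsact_hom orbit_base_fixed.
have [f fx] := orbit_hom_ex x_fix.
exists (Fplus_lift f); split.
  move=> m c; rewrite (Fplus_adjunction (from_empty X)).2 => [|? []].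
  by rewrite [RHS](Fplus_adjunction (from_empty X)).2 => [|? []].
(* A morphism out of the free operad is recovered from its values on generators, and by equivariance
   from the base point. *)
have e (h : marked_hom (Fplus (orbit_seq Gam)) Y) :=
  (Fplus_adjunction (seq_comp h (Fplus_unit _))).2 h (fun _ _ => erefl).
move=> m c; rewrite (e b); apply: (Fplus_adjunction _).2 => {m c} m a0 /=.
have /= -> := (Fplus_adjunction f).1 m a0.
have [g [t ea]] := orbit_generated a0; have /= enm := congr1 tag ea.
case: _ / (esym enm) in a0 ea *; rewrite (eq_from_Tagged ea).
have eu := gsact_hom (Fplus_unit (orbit_seq Gam)) g t (orbit_base Gam).
rewrite /= in eu; rewrite eu !gsact_hom fx ex //.
Qed.

(** * Coproducts of cofibrant operads *)

Section Cofibrant.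
Variable gT : finGroupType.
Implicit Types O P Q : marked_operad gT.

Lemma initial_hom_eq O (h h' : marked_hom (initial_operad gT) O) : hom_eq h h'.
Proof. by move=> n x; rewrite !from_initial_unique. Qed.

Lemma cofibrant_coprod O P : cofibrant O -> cofibrant P -> cofibrant (coprod O P).
Proof.
move=> cO cP X Y p p_fib a b _.
have [|lO [_ elO]] := cO X Y p p_fib a (marked_comp b (coprod_inl O P)).
  exact: initial_hom_eq.
have [|lP [_ elP]] := cP X Y p p_fib a (marked_comp b (coprod_inr O P)).
  exact: initial_hom_eq.
have [e1 e2 _] := coprod_universal lO lP.
have [_ _ uniq_b] := coprod_universal
  (marked_comp b (coprod_inl O P)) (marked_comp b (coprod_inr O P)).
exists (copair lO lP); split; first exact: initial_hom_eq.
move=> n x; rewrite (uniq_b (marked_comp p (copair lO lP))) => [|m y|m y].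
- by rewrite -(uniq_b b).
- by have /= -> := e1 m y; apply: elO.
- by have /= -> := e2 m y; apply: elP.
Qed.

Lemma has_fixed_hom O P (f : marked_hom O P) n (Gam : graph_subgroup gT n) :
  has_fixed O Gam -> has_fixed P Gam.
Proof. by case=> x x_fix; exists (f n x) => h; rewrite -gsact_hom x_fix. Qed.

Lemma cofibrant_hom O Q : cofibrant O ->
  hclass_le (admissible O) (admissible Q) -> exists f : marked_hom O Q, True.
Proof.
move=> cO leOQ.
have fib : acyclic_fibration (prod_fst O Q).
  apply: acyclic_fibration_fixed => n Gam x x_fix.
  have [y y_fix] : has_fixed Q Gam.
    apply: (has_fixed_admissible Q Gam).2; apply: leOQ.
    by apply: (has_fixed_admissible O Gam).1; exists x.
  by exists (x, y) => // h; rewrite -[in RHS](x_fix h) -[in RHS](y_fix h).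
have idO : marked_hom O O.
  by exists (@SeqHom gT O O (fun n x => x)
    (fun _ _ _ => erefl) (fun _ _ _ => erefl)).
have [|l _] := cO _ _ _ fib (from_initial _) idO; first exact: initial_hom_eq.
by exists (marked_comp (prod_snd O Q) l).
Qed.

Lemma admissible_coprod O P : cofibrant O -> cofibrant P ->
  is_join (admissible O) (admissible P) (admissible (coprod O P)).
Proof.
move=> cO cP; split.
- exact: admissible_indexing.
- by move=> H T; apply: (has_fixed_hom (coprod_inl O P)).
- by move=> H T; apply: (has_fixed_hom (coprod_inr O P)).
move=> M M_indexing leO leP H T opT.
have [|f _] := @cofibrant_hom O (good_marked M_indexing) cO.
  by move=> K U /leO MU; apply/admissible_good.
have [|g _] := @cofibrant_hom P (good_marked M_indexing) cP.
  by move=> K U /leP MU; apply/admissible_good.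
by apply/(admissible_good M_indexing)/(has_fixed_hom (copair f g)).
Qed.

End Cofibrant.

Theorem proposition4p11 (gT : finGroupType) :
  (forall O P : marked_operad gT, cofibrant O -> cofibrant P ->
     cofibrant (coprod O P) /\
     is_join (admissible O) (admissible P) (admissible (coprod O P))) /\
  (forall O : marked_operad gT, cofibrant O ->
     forall (P P' : marked_operad gT) (f : marked_hom P P'),
       cofibrant P -> cofibrant P' ->
       weak_equiv f -> weak_equiv (coprod_map O f)).
Proof.
split=> [O P cO cP|O cO P P' f cP cP' f_we n Gam].
  by split; [apply: cofibrant_coprod|apply: admissible_coprod].
(* By [f_we], sets admissible for [P'] are admissible for [P], so the indexing system of
   [coprod O P] contains those of [O] and [P'], hence their join. *)
have [_ _ _ least] := admissible_coprod cO cP'.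
have [indexing leO leP _] := admissible_coprod cO cP.
rewrite !has_fixed_admissible; apply: least => // H T opT.
exact/leP/f_we.
Qed.
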